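(* Let $\ell=\max_{k\le K}\ell_k$ with measurable $\ell_k:\mathbb{R}^m\to\overline{\mathbb{R}}$. Assume that $\Xi\subseteq\mathbb{R}^m$ is convex and closed, that $-\ell_k$ is proper, convex and lower semicontinuous for all $k\le K$, and that $\ell_k$ is not identically $-\infty$ on $\Xi$ for all $k\le K$. Then, for every $\varepsilon\ge0$, the worst-case expectation $\sup_{\mathbb{Q}\in\mathbb{B}_\varepsilon(\widehat{\mathbb{P}}_N)}\mathbb{E}^{\mathbb{Q}}[\ell(\xi)]$ coincides with the optimal value of the finite convex program $$\begin{array}{cll}\sup\limits_{\alpha_{ik},q_{ik}}&\frac1N\sum\limits_{i=1}^N\sum\limits_{k=1}^K\alpha_{ik}\,\ell_k\big(\widehat\xi_i-\frac{q_{ik}}{\alpha_{ik}}\big)&\\ \text{s.t.}&\frac1N\sum\limits_{i=1}^N\sum\limits_{k=1}^K\|q_{ik}\|\le\varepsilon&\\ &\sum\limits_{k=1}^K\alpha_{ik}=1&\forall i\le N\\ &\alpha_{ik}\ge0&\forall i\le N,\ \forall k\le K\\ &\widehat\xi_i-\frac{q_{ik}}{\alpha_{ik}}\in\Xi&\forall i\le N,\ \forall k\le K,\end{array}$$ with $\alpha_{ik}\in\mathbb{R}$ and $q_{ik}\in\mathbb{R}^m$. Let $\{\alpha_{ik}(r),q_{ik}(r)\}_{r\in\mathbb{N}}$ be a sequence of feasible decisions whose objective values converge to the supremum of this program. Then the discrete probability distributions $$\mathbb{Q}_r=\frac1N\sum_{i=1}^N\sum_{k=1}^K\alpha_{ik}(r)\,\delta_{\xi_{ik}(r)},\qquad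 \xi_{ik}(r)=\widehat\xi_i-\frac{q_{ik}(r)}{\alpha_{ik}(r)},$$ belong to the Wasserstein ball $\mathbb{B}_\varepsilon(\widehat{\mathbb{P}}_N)$ and attain the supremum of the worst-case expectation asymptotically, i.e., $$\sup_{\mathbb{Q}\in\mathbb{B}_\varepsilon(\widehat{\mathbb{P}}_N)}\mathbb{E}^{\mathbb{Q}}[\ell(\xi)]=\lim_{r\to\infty}\mathbb{E}^{\mathbb{Q}_r}[\ell(\xi)]=\lim_{r\to\infty}\frac1N\sum_{i=1}^N\sum_{k=1}^K\alpha_{ik}(r)\,\ell\big(\xi_{ik}(r)\big).$$
   Context: Notation: $\overline{\mathbb{R}}=\mathbb{R}\cup\{-\infty,\infty\}$; $\|\cdot\|$ is an arbitrary norm on $\mathbb{R}^m$. A function $f:\mathbb{R}^m\to\overline{\mathbb{R}}$ is proper if $f(\xi)<+\infty$ for at least one $\xi$ and $f(\xi)>-\infty$ for all $\xi$. Conventions of extended arithmetic: $\infty\cdot0=0\cdot\infty=0/0=0$ and $\infty-\infty=-\infty+\infty=1/0=\infty$. In particular, if $\alpha_{ik}=0$ and $q_{ik}\ne0$, then $q_{ik}/\alpha_{ik}$ has an infinite component, so $\widehat\xi_i-q_{ik}/\alpha_{ik}\notin\Xi$; if $\alpha_{ik}=0$ and $q_{ik}=0$, then $\widehat\xi_i-q_{ik}/\alpha_{ik}=\widehat\xi_i\in\Xi$; and the $ik$-th term of the objective is $0$ whenever $\alpha_{ik}=0$. Expectations are $\mathbb{E}^{\mathbb{Q}}[\ell(\xi)]=\mathbb{E}^{\mathbb{Q}}[\max\{\ell(\xi),0\}]+\mathbb{E}^{\mathbb{Q}}[\min\{\ell(\xi),0\}]$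 under these conventions. Data and ball: $\widehat\xi_1,\dots,\widehat\xi_N\in\Xi$ are given points and $\widehat{\mathbb{P}}_N=\frac1N\sum_{i=1}^N\delta_{\widehat\xi_i}$. $\mathcal{M}(\Xi)$ is the set of probability distributions $\mathbb{Q}$ supported on $\Xi$ with $\mathbb{E}^{\mathbb{Q}}[\|\xi\|]<\infty$; $d_{\mathrm W}(\mathbb{Q}_1,\mathbb{Q}_2)=\inf_\Pi\int_{\Xi^2}\|\xi_1-\xi_2\|\,\Pi(d\xi_1,d\xi_2)$ over joint distributions $\Pi$ with marginals $\mathbb{Q}_1,\mathbb{Q}_2$; $\mathbb{B}_\varepsilon(\widehat{\mathbb{P}}_N)=\{\mathbb{Q}\in\mathcal{M}(\Xi):d_{\mathrm W}(\widehat{\mathbb{P}}_N,\mathbb{Q})\le\varepsilon\}$. *)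

(* Defs.v *)
From HB Require Import structures.
From mathcomp Require Import all_boot all_order all_algebra.
From mathcomp Require Import all_classical all_reals all_analysis.
From mathcomp Require Import measurable_realfun.

Set Implicit Arguments.
Unset Strict Implicit.
Unset Printing Implicit Defensive.

Import Order.TTheory GRing.Theory Num.Theory.
Import numFieldNormedType.Exports.

Local Open Scope classical_set_scope.
Local Open Scope ring_scope.
Local Open Scope convex_scope.

(* The intended extended arithmetic has oo * 0 = 0 * oo = 0 / 0 = 0, 1 / 0 = oo
   and oo - oo = oo.  [mule] and [inve] (with [inve 0 = +oo]) follow these
   conventions, but [+oo + -oo] is [+oo] only in [ereal_dual_scope] ([%dE]):
   the addition of [ereal_scope] gives [-oo].  Hence the uses of [%dE] below. *)

Notation borelRV R m := (g_sigma_algebraType (@open 'rV[R]_m)).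

Definition is_norm (R : realType) (V : lmodType R) (nrm : V -> R) : Prop :=
  [/\ forall x, 0 <= nrm x,
      forall x, nrm x = 0 -> x = 0,
      forall a x, nrm (a *: x) = `|a| * nrm x &
      forall x y, nrm (x + y) <= nrm x + nrm y].

Definition proper_fun (R : realType) (T : Type) (f : T -> \bar R) : Prop :=
  (exists x, f x < +oo)%E /\ (forall x, -oo < f x)%E.

Definition convex_efun (R : realType) (V : lmodType R)
    (D : set (convex_lmodType V)) (f : convex_lmodType V -> \bar R) : Prop :=
  forall (t : {i01 R}), {in D &, forall x y,
    f (x <| t |> y) <=
      ((t%:num)%:E * f x + ((1 - t%:num)%:E * f y))%dE}%E.

Section discrete_distribution.
Context d (T : measurableType d) (R : realType) (I : finType).
Variables (w : I -> R) (x : I -> T).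

Definition discrete (w_ge0 : forall i, 0 <= w i) (w_sum1 : \sum_i w i = 1)
  (A : set T) : \bar R := (\sum_i (w i)%:E * \d_(x i) A)%E.

Variables (w_ge0 : forall i, 0 <= w i) (w_sum1 : \sum_i w i = 1).
Local Notation mu := (discrete w_ge0 w_sum1).

Let mu0 : mu set0 = 0%E.
Proof. by rewrite /discrete big1// => i _; rewrite measure0 mule0. Qed.

Let mu_ge0 A : (0 <= mu A)%E.
Proof. by apply: sume_ge0 => i _; rewrite mule_ge0// lee_fin. Qed.

Let mu_sigma_additive : semi_sigma_additive mu.
Proof.
move=> F mF tF mUF; rewrite /discrete.
under eq_fun do rewrite exchange_big/=.
apply: cvg_nnesum => [i _|i _].
  by apply: nearW => n; apply: sume_ge0 => j _; rewrite mule_ge0// lee_fin.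
exact: (@measure_semi_sigma_additive _ _ _
  (mscale (NngNum (w_ge0 i)) (\d_(x i))) F mF tF mUF).
Qed.

HB.instance Definition _ := isMeasure.Build d T R mu mu0 mu_ge0
  mu_sigma_additive.

Let mu_setT : mu setT = 1%E.
Proof.
rewrite /discrete -[RHS]/(1%:E) -w_sum1 -sumEFin; apply: eq_bigr => i _.
by rewrite diracT mule1.
Qed.

HB.instance Definition _ := Measure_isProbability.Build d T R mu mu_setT.

Definition discrete_distribution : probability T R := mu.

End discrete_distribution.

Section wasserstein.
Context (R : realType) (m : nat).
Variables (nrm : 'rV[R]_m -> R) (Xi : set 'rV[R]_m).
Implicit Types Q : probability (borelRV R m) R.

(* For a closed Xi, [Q Xi = 1] says that the support of Q is included in Xi. *)
Definition distributions : set (probability (borelRV R m) R) :=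
  [set Q | Q (Xi : set (borelRV R m)) = 1%E /\ (\int[Q]_x (nrm x)%:E < +oo)%E].

Definition coupling Q1 Q2 :
    set (probability (borelRV R m * borelRV R m)%type R) :=
  [set Pi | (forall A, measurable A -> Pi (fst @^-1` A) = Q1 A) /\
            (forall A, measurable A -> Pi (snd @^-1` A) = Q2 A)].

Definition wasserstein Q1 Q2 : \bar R :=
  ereal_inf [set (\int[Pi]_(z in Xi `*` Xi)
                    (nrm ((z.1 : 'rV[R]_m) - (z.2 : 'rV[R]_m)))%:E)%E
            | Pi in coupling Q1 Q2].

Definition wasserstein_ball Q0 (eps : R) : set (probability (borelRV R m) R) :=
  [set Q | distributions Q /\ (wasserstein Q0 Q <= eps%:E)%E].

End wasserstein.

(* Agrees with the integral of f unless f^+ and f^- both have an infinite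
   integral, in which case the value is +oo (and not -oo). *)
Definition eexpectation d (T : measurableType d) (R : realType)
    (P : probability T R) (f : T -> \bar R) : \bar R :=
  ((\int[P]_x maxe (f x) 0)%E + (\int[P]_x mine (f x) 0)%E)%dE.

Section program.
Context (R : realType) (m N K : nat).
Variables (nrm : 'rV[R]_m -> R) (Xi : set 'rV[R]_m).
Variable (xihat : 'I_N -> 'rV[R]_m).
Variables (ell : 'I_K -> 'rV[R]_m -> \bar R) (eps : R).

Lemma empirical_sum1 (N_gt0 : (0 < N)%N) : \sum_(i < N) (N%:R^-1 : R) = 1.
Proof.
rewrite sumr_const card_ord -[LHS]mulr_natr mulVf//.
by rewrite pnatr_eq0 -lt0n.
Qed.

Lemma empirical_ge0 (i : 'I_N) : 0 <= (N%:R^-1 : R).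
Proof. by rewrite invr_ge0. Qed.

Definition empirical_distribution (N_gt0 : (0 < N)%N) :
    probability (borelRV R m) R :=
  discrete_distribution (xihat : 'I_N -> borelRV R m)
    empirical_ge0 (empirical_sum1 N_gt0).

Definition max_loss (x : 'rV[R]_m) : \bar R :=
  \big[maxe/-oo%E]_(k < K) ell k x.

(* Pairs (alpha, q) of decision variables. *)
Definition decision : lmodType R :=
  ('M[R]_(N, K) * ('I_N -> 'I_K -> 'rV[R]_m))%type.

Implicit Type v : decision.

(* xihat_i - q_ik / alpha_ik in extended arithmetic: for alpha_ik = 0 this is
   xihat_i if q_ik = 0, and has an infinite component otherwise. *)
Definition extended_atom v (i : 'I_N) (k : 'I_K) : 'rV[\bar R]_m :=
  \row_j ((xihat i 0 j)%:E - (v.2 i k 0 j)%:E / (v.1 i k)%:E)%E.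

(* The same point as an element of R^m; only meaningful when the extended atom
   has no infinite component, which feasibility guarantees. *)
Definition atom v (i : 'I_N) (k : 'I_K) : 'rV[R]_m :=
  map_mx fine (extended_atom v i k).

Definition objective v : \bar R :=
  ((N%:R^-1)%:E *
     \sum_(i < N) \sum_(k < K) (v.1 i k)%:E * ell k (atom v i k))%dE.

Definition feasible : set decision :=
  [set v : decision | [/\ N%:R^-1 * (\sum_(i < N) \sum_(k < K) nrm (v.2 i k)) <= eps,
               forall i, \sum_(k < K) v.1 i k = 1,
               forall i k, 0 <= v.1 i k &
               forall i k,
                 [set map_mx EFin x | x in Xi] (extended_atom v i k)]].

Definition optimal_value : \bar R :=
  ereal_sup [set objective v | v in feasible].

(* Maximization of a concave objective over a convex feasible set. *)
Definition convex_program : Prop :=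
  convex_set feasible /\ convex_efun feasible (fun v => - objective v)%E.

Lemma weights_ge0 v : feasible v ->
  forall p : 'I_N * 'I_K, 0 <= N%:R^-1 * v.1 p.1 p.2.
Proof. by move=> [_ _ a_ge0 _] p; rewrite mulr_ge0// invr_ge0. Qed.

Lemma weights_sum1 (N_gt0 : (0 < N)%N) v : feasible v ->
  \sum_(p : 'I_N * 'I_K) N%:R^-1 * v.1 p.1 p.2 = 1.
Proof.
move=> [_ a_sum1 _ _].
rewrite -(pair_bigA _ (fun i k => N%:R^-1 * v.1 i k))/=.
rewrite -[RHS](empirical_sum1 N_gt0); apply: eq_bigr => i _.
by rewrite -mulr_sumr a_sum1 mulr1.
Qed.

(* 1/N sum_ik alpha_ik delta_{xihat_i - q_ik / alpha_ik} *)
Definition decision_distribution (N_gt0 : (0 < N)%N) v (fv : feasible v) :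
    probability (borelRV R m) R :=
  discrete_distribution
    (fun p : 'I_N * 'I_K => atom v p.1 p.2 : borelRV R m)
    (weights_ge0 fv) (weights_sum1 N_gt0 fv).

Definition worst_case_expectation (N_gt0 : (0 < N)%N) : \bar R :=
  ereal_sup [set eexpectation Q max_loss
            | Q in wasserstein_ball nrm Xi (empirical_distribution N_gt0) eps].

End program.

(* Main.v *)
Require Import Defs.
From HB Require Import structures.
From mathcomp Require Import all_boot all_order all_algebra.
From mathcomp Require Import all_classical all_reals all_analysis.
From mathcomp Require Import measurable_realfun.
From mathcomp Require Import ring lra.

Set Implicit Arguments.
Unset Strict Implicit.
Unset Printing Implicit Defensive.

Import Order.TTheory GRing.Theory Num.Theory.
Import numFieldNormedType.Exports.

Local Open Scope classical_set_scope.
Local Open Scope ring_scope.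

(** The optimal value bounds the worst-case expectation from below because a
    feasible decision is a transport plan: it splits the mass of each sample
    [xihat i] among the atoms [xihat i - q i k / alpha i k], at a cost equal to
    the left-hand side of the budget constraint. Hence its distribution lies in
    the ball ([decision_distribution_ball]), and its objective is at most the
    expectation of the loss, as each [ell k] is at most their maximum
    ([objective_le_expectation]). This also settles the asymptotic statement:
    the expectations are squeezed between objectives that tend to the optimal
    value and the worst-case expectation.

    For the converse, regard the value of the program as a function of its
    budget, and call [(c, o)] attainable when some decision of cost at most [c]
    has objective at least [o]. Perspectives of concave functions are
    superadditive, so attainable points form a convex set
    ([attainable_conv]). Take [Q] in the ball and a real [a] below the
    expectation of the loss under [Q]. Lagrangian duality for the transport
    constraint is easy in one direction: for each slope [l >= 0], integrating
    the [c]-transform of the loss against a nearly optimal coupling gives an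
    attainable point strictly above the line of slope [l] through [(eps, a)]
    ([weak_duality]). A separation argument in the plane turns this into an
    attainable point [(eps, o)] with [a <= o] ([dual_attained]).

    The separation argument needs closedness at [eps] when no budget below [eps]
    allows a finite objective, for instance when [eps = 0]. It holds by
    compactness ([attainable_limit]). The only defect of compactness is that an
    atom may escape to infinity while its mass vanishes and its displacement [q]
    does not. As the [ell k] grow at most linearly ([linear_growth]), dropping
    such an atom forfeits no more than a constant times the budget that it
    frees, so a limit decision that spends all of [eps] forfeits nothing. *)

(** * Norms on row vectors *)

Section norms.
Context (R : realType) (m : nat) (nrm : 'rV[R]_m -> R).
Hypothesis nrm_norm : is_norm nrm.
Implicit Types x y z : 'rV[R]_m.

Lemma is_norm_ge0 x : 0 <= nrm x.
Proof. by case: nrm_norm. Qed.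

Lemma is_normZ a x : nrm (a *: x) = `|a| * nrm x.
Proof. by case: nrm_norm. Qed.

Lemma is_norm_triangle x y : nrm (x + y) <= nrm x + nrm y.
Proof. by case: nrm_norm. Qed.

Lemma is_norm0 : nrm 0 = 0.
Proof. by rewrite -(scale0r 0) is_normZ normr0 mul0r. Qed.

Lemma is_normN x : nrm (- x) = nrm x.
Proof. by rewrite -scaleN1r is_normZ normrN1 mul1r. Qed.

Lemma is_norm_sum (I : finType) (F : I -> 'rV[R]_m) :
  nrm (\sum_i F i) <= \sum_i nrm (F i).
Proof.
elim/big_ind2 : _ => [|x a y b xa yb|//]; first by rewrite is_norm0.
by rewrite (le_trans (is_norm_triangle _ _))// lerD.
Qed.

Lemma le_mx_norm x j : `|x 0 j| <= `|x|.
Proof.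
rewrite -[leRHS]/(mx_norm x) mx_normrE.
by apply/bigmax_geP; right => /=; exists (0, j).
Qed.

Lemma is_norm_le_mx : exists2 C, 0 <= C & forall x, nrm x <= C * `|x|.
Proof.
exists (\sum_j nrm (delta_mx 0 j)).
  by apply: sumr_ge0 => j _; exact: is_norm_ge0.
move=> x; rewrite {1}(row_sum_delta x) (le_trans (is_norm_sum _))//.
rewrite mulr_suml ler_sum// => j _.
by rewrite is_normZ mulrC ler_wpM2l ?is_norm_ge0 ?le_mx_norm.
Qed.

(** A function that is Lipschitz for [nrm] is Lipschitz for the sup norm that
    carries the topology, since [nrm] is dominated by the latter. *)
Lemma lipschitz_continuous (f : 'rV[R]_m -> R) (L : R) : 0 <= L ->
  (forall x y, f x <= f y + L * nrm (x - y)) -> continuous f.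
Proof.
move=> L0 fL; have [C C0 nrmC] := is_norm_le_mx.
move=> x; apply/(@cvgrPdist_lt _ _ _ (nbhs x) (nbhs_filter x)) => e e0.
have D0 : 0 < L * C + 1 by rewrite ltr_wpDl// mulr_ge0.
have /cvgrPdist_lt/(_ _ (divr_gt0 e0 D0)) := @cvg_id _ (nbhs x).
apply: (@filterS _ _ (nbhs_filter x)) => y yx.
have xy : nrm (x - y) <= C * `|x - y| by exact: nrmC.
have yx' : nrm (y - x) <= C * `|x - y| by rewrite -is_normN opprB.
apply: (@le_lt_trans _ _ (L * C * `|x - y|)).
  rewrite ler_norml -mulrA; apply/andP; split.
    rewrite lerNl opprB lerBlDl (le_trans (fL y x))// lerD2l.
    by rewrite ler_wpM2l.
  by rewrite lerBlDl (le_trans (fL x y))// lerD2l ler_wpM2l.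
apply: (@le_lt_trans _ _ ((L * C + 1) * `|x - y|)).
  by rewrite ler_wpM2r// lerDl.
by rewrite mulrC -ltr_pdivlMr.
Qed.

Lemma is_norm_continuous : continuous nrm.
Proof.
apply: (@lipschitz_continuous _ 1) => // x y; rewrite mul1r.
by rewrite -[x in leLHS](subrK y) addrC is_norm_triangle.
Qed.

Lemma compact_mx_ball r : compact [set x : 'rV[R]_m | `|x| <= r].
Proof.
apply: bounded_closed_compact.
  exists r; split; first by rewrite num_real.
  by move=> M rM x /= /le_trans; apply; exact: ltW.
apply: (@preimage_closed _ _ (fun x : 'rV[R]_m => `|x|) [set y | y <= r]).
  by move=> x _; exact: (@norm_continuous _ 'rV[R]_m x).
exact: closed_le.
Qed.

(** Otherwise some sequence of sup-norm unit vectors would have [nrm] tending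
    to zero, and a cluster point of it would be a unit vector of [nrm] zero. *)
Lemma mx_le_is_norm : exists2 C, 0 <= C & forall x, `|x| <= C * nrm x.
Proof.
apply: contrapT => H.
have {}H (n : nat) : {x | `|x| = 1 & nrm x <= n.+1%:R^-1}.
  apply: cid2; apply: contrapT => H1; apply: H; exists n.+1%:R => // x.
  have [->|x0] := eqVneq x 0; first by rewrite normr0 mulr_ge0// is_norm_ge0.
  rewrite leNgt; apply/negP => nx; apply: H1.
  have x0' : 0 < `|x| by rewrite normr_gt0.
  exists (`|x|^-1 *: x).
    by rewrite normrZ ger0_norm ?invr_ge0// mulVf// gt_eqF.
  rewrite is_normZ ger0_norm ?invr_ge0// mulrC ler_pdivrMr//.
  by rewrite -(ler_pM2l (ltr0Sn R n)) mulrA divff// mul1r ltW.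
pose u n := s2val (H n).
have u1 n : `|u n| = 1 by rewrite /u; case: (H n).
have un n : nrm (u n) <= n.+1%:R^-1 by rewrite /u; case: (H n).
have /(_ (u @ \oo)%classic)[] := @compact_mx_ball 1.
  by exists 0%N => // n _ /=; rewrite u1.
move=> p [_ clp].
have np : nrm p = 0.
  apply/eqP; rewrite eq_le is_norm_ge0 andbT leNgt; apply/negP => p0.
  have /clp : (u @ \oo)%classic [set x | nrm x <= nrm p / 2].
    have e0 : 0 < nrm p / 2 by rewrite divr_gt0.
    have := near_infty_natSinv_lt (PosNum e0).
    by apply: filterS => n /= /ltW; exact/le_trans/un.
  move=> /(_ [set x | nrm p / 2 < nrm x])[].
    have := @is_norm_continuous p.
    move=> /cvgr_gt; apply; by rewrite ltr_pdivrMr// ltr_pMr// ltr1n.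
  by move=> x /= [] /le_lt_trans /[apply]; rewrite ltxx.
have p0 : p = 0 by case: nrm_norm => _ + _ _; exact.
have /clp : (u @ \oo)%classic [set x | `|x| = 1].
  by exists 0%N => // n _ /=; rewrite u1.
move=> /(_ [set x | `|x| < 1])[].
  have := @norm_continuous _ 'rV[R]_m p; move=> /cvgr_lt; apply.
  by rewrite p0 normr0.
by move=> x /= [-> ]; rewrite ltxx.
Qed.

End norms.

(** * Sums of extended reals *)

Section extended_reals.
Context (R : realType).

(** The two conventions for [oo - oo] agree on sums that avoid [+oo]. *)
Lemma dsum_ltey (I : finType) (F : I -> \bar R) : (forall i, F i < +oo)%E ->
  (\sum_i F i)%dE = (\sum_i F i)%E.
Proof.
move=> Foo.
suff [] : (\sum_i F i)%dE = (\sum_i F i)%E /\ (\sum_i F i < +oo)%E by [].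
elim/big_ind2 : _ => [|x a y b [-> aoo] [-> boo]|i _]; rewrite ?ltry//.
split; last by rewrite lte_add_pinfty.
by rewrite DualAddTheoryNumDomain.dual_addeE_def// ltpinfty_adde_def// inE.
Qed.

(** A real lower bound on a sum that avoids [+oo] forces every term to be real,
    so that inequalities about the objective can be split termwise in [R]. *)
Lemma le_sum_realP (I : finType) (F : I -> \bar R) (o : R) :
  (forall i, F i < +oo)%E -> (o%:E <= \sum_i F i)%E ->
  exists2 T : I -> R, o <= \sum_i T i & forall i, F i = (T i)%:E.
Proof.
move=> Foo oF.
have Ffin i : F i \is a fin_num.
  rewrite fin_numE; apply/andP; split; last by rewrite lt_eqF.
  apply/eqP => Fi.
  have /eqP : (\sum_i F i)%E == -oo%E.
    by rewrite esum_eqNy; apply/existsP; exists i; rewrite Fi/=.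
  by move=> FN; move: oF; rewrite FN leeNy_eq.
exists (fun i => fine (F i)); last by move=> i; rewrite fineK.
by rewrite -lee_fin -sumEFin (le_trans oF)// lee_sum// => i _; rewrite fineK.
Qed.

Lemma lee_real_lt (x y : \bar R) :
  (forall a : R, (a%:E < x)%E -> (a%:E <= y)%E) -> (x <= y)%E.
Proof.
move: x y => [x| |] [y| |] H //; rewrite ?leey ?leNye//.
- rewrite lee_fin; apply/ler_addgt0Pr => e e0; rewrite -lerBlDr -lee_fin.
  by apply: H; rewrite lte_fin ltrBlDr ltrDl.
- have := H (x - 1); rewrite lte_fin ltrBlDr ltrDl ltr01 => /(_ isT).
  by rewrite leeNy_eq.
- have := H (y + 1); rewrite ltry => /(_ isT).
  by rewrite lee_fin gerDl ler10.
- by have := H 0; rewrite ltry => /(_ isT); rewrite leeNy_eq.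
Qed.

End extended_reals.

(** * Perspectives of concave functions *)

Section perspective.
Context (R : realType) (m : nat) (f : 'rV[R]_m -> \bar R).
Hypothesis f_proper : proper_fun (fun x => - f x)%E.
Hypothesis f_convex : convex_efun setT (fun x => - f x)%E.
Implicit Types (x y : 'rV[R]_m) (a b r s t : R).

Lemma proper_lty x : (f x < +oo)%E.
Proof. by case: f_proper => _ /(_ x); rewrite lteNr. Qed.

Lemma perspective_lty a x : 0 <= a -> (a%:E * f x < +oo)%E.
Proof. by move=> a0; rewrite lte_mul_pinfty// proper_lty. Qed.

Lemma concave_real t x y r s : 0 <= t -> t <= 1 ->
  (r%:E <= f x)%E -> (s%:E <= f y)%E ->
  ((t * r + (1 - t) * s)%:E <= f (t *: x + (1 - t) *: y))%E.
Proof.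
move=> t0 t1.
have t01 : Itv.spec (@Itv.num_sem R) (Itv.Real `[0%Z, 1%Z]) t.
  by rewrite /Itv.spec/=/Itv.num_sem num_real/= in_itv/= t0 t1.
have := f_convex (Itv.mk t01) (mem_set (I : setT x)) (mem_set (I : setT y)).
have -> : @conv R (convex_lmodType _) (Itv.mk t01) x y =
    t *: x + (1 - t) *: y by [].
rewrite /=.
have := proper_lty x; have := proper_lty y.
have := proper_lty (t *: x + (1 - t) *: y).
case: (f x) => [fx||]//; case: (f y) => [fy||]//; case: (f (_ + _)) => [fz||]//.
rewrite /= !lee_fin => _ _ _ H rx sy.
have := ler_wpM2l t0 rx.
have : (1 - t) * s <= (1 - t) * fy by rewrite ler_wpM2l// subr_ge0.
by lra.
Qed.

(** Center of the masses [a] at [x] and [b] at [y]. Without mass it is [x0], as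
    the massless atoms of a decision lie at their sample. *)
Definition barycenter (x0 : 'rV[R]_m) a b x y :=
  if a + b == 0 then x0 else (a / (a + b)) *: x + (b / (a + b)) *: y.

Lemma barycenterE x0 a b x y : 0 <= a -> 0 <= b ->
  (a + b) *: (x0 - barycenter x0 a b x y) = a *: (x0 - x) + b *: (x0 - y).
Proof.
move=> a0 b0; rewrite /barycenter; case: ifPn => [|ab0].
  by rewrite paddr_eq0// => /andP[/eqP-> /eqP->]; rewrite addr0 !scale0r addr0.
rewrite scalerBr scalerDr !scalerA !(mulrCA (a + b)) !divff// !mulr1.
by rewrite !scalerBr scalerDl opprD addrACA.
Qed.

(** A positively homogeneous concave function is superadditive; massless points
    contribute nothing, wherever they are and even if [f] is [-oo] there. *)
Lemma perspective_superadditive x0 a b x y r s : 0 <= a -> 0 <= b ->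
  (r%:E <= a%:E * f x)%E -> (s%:E <= b%:E * f y)%E ->
  ((r + s)%:E <= (a + b)%:E * f (barycenter x0 a b x y))%E.
Proof.
rewrite !le0r => /orP[/eqP->|a0] /orP[/eqP->|b0]; rewrite ?mul0e ?lee_fin.
- by move=> r0 s0; rewrite addr0 mul0e lee_fin; lra.
- move=> r0 sb; rewrite add0r /barycenter add0r gt_eqF// mul0r scale0r add0r.
  by rewrite divff ?gt_eqF// scale1r (le_trans _ sb)// lee_fin; lra.
- move=> ra s0; rewrite addr0 /barycenter addr0 gt_eqF// mul0r scale0r addr0.
  by rewrite divff ?gt_eqF// scale1r (le_trans _ ra)// lee_fin; lra.
move=> ra sb; have ab0 : 0 < a + b by rewrite addr_gt0.
have lefr c z q : 0 < c -> (q%:E <= c%:E * f z)%E -> ((q / c)%:E <= f z)%E.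
  move=> c0 qc; rewrite -(@lee_pmul2l _ c%:E) ?lte_fin// -EFinM mulrCA.
  by rewrite divff ?gt_eqF// mulr1.
rewrite /barycenter gt_eqF//.
have -> : b / (a + b) = 1 - a / (a + b) by field; rewrite gt_eqF.
have t0 : 0 <= a / (a + b) by rewrite divr_ge0// ltW.
have t1 : a / (a + b) <= 1 by rewrite ler_pdivrMr// mul1r lerDl ltW.
have := concave_real t0 t1 (lefr _ _ _ a0 ra) (lefr _ _ _ b0 sb).
rewrite -(@lee_pmul2l _ (a + b)%:E)// ?lte_fin//.
rewrite -EFinM; congr (_%:E <= _)%E.
by field; rewrite !gt_eqF.
Qed.

End perspective.

(** * Feasible decisions as families of weighted points *)

Section decisions.
Context (R : realType) (m N K : nat).
Variables (nrm : 'rV[R]_m -> R) (Xi : set 'rV[R]_m).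
Variables (xihat : 'I_N -> 'rV[R]_m) (ell : 'I_K -> 'rV[R]_m -> \bar R).
Hypotheses (N_gt0 : (0 < N)%N) (nrm_norm : is_norm nrm).
Hypothesis (Xi_convex : convex_set Xi).
Hypothesis xihat_Xi : forall i, Xi (xihat i).
Hypothesis ell_proper : forall k, proper_fun (fun x => - ell k x)%E.
Hypothesis ell_convex : forall k, convex_efun setT (fun x => - ell k x)%E.
Implicit Types (v : decision R m N K) (c o t : R).

Lemma extended_atomE v i k x : v.2 i k = v.1 i k *: (xihat i - x) ->
  extended_atom xihat v i k =
  map_mx EFin (if v.1 i k == 0 then xihat i else x).
Proof.
move=> vx; apply/rowP => j; rewrite !mxE vx !mxE inver.
case: ifPn => [/eqP->|a0].
  by rewrite mul0r mul0e sube0.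
by rewrite -EFinM mulrC mulrA mulVf// mul1r -EFinB opprB addrC subrK.
Qed.

Lemma atomE v i k x : v.2 i k = v.1 i k *: (xihat i - x) ->
  atom xihat v i k = if v.1 i k == 0 then xihat i else x.
Proof.
move=> /extended_atomE vx; rewrite /atom vx.
by apply/rowP => j; rewrite !mxE.
Qed.

(** Since [v.1 i k = 0] makes every nonzero component of the quotient infinite,
    a real atom forces [v.2 i k = 0] there, and no division is left. *)
Lemma extended_atom_displacement v i k x :
  extended_atom xihat v i k = map_mx EFin x ->
  v.2 i k = v.1 i k *: (xihat i - x) /\ atom xihat v i k = x.
Proof.
move=> vx; split; last by rewrite /atom vx; apply/rowP => j; rewrite !mxE.
apply/rowP => j; move/rowP : vx => /(_ j); rewrite !mxE inver.
case: ifPn => [/eqP->|a0].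
  rewrite mul0r mulry; case: (sgrP (v.2 i k 0 j)) => //.
    by rewrite mul1e.
  by rewrite mulN1e.
by rewrite -EFinM -EFinB => -[<-]; field.
Qed.

Lemma feasibleP c v : feasible nrm Xi xihat c v <->
  [/\ N%:R^-1 * (\sum_(i < N) \sum_(k < K) nrm (v.2 i k)) <= c,
      forall i, \sum_(k < K) v.1 i k = 1,
      forall i k, 0 <= v.1 i k &
      forall i k, Xi (atom xihat v i k) /\
        v.2 i k = v.1 i k *: (xihat i - atom xihat v i k)].
Proof.
split=> -[vc v1 v0 vXi]; split=> // i k.
  have [x xXi /esym/extended_atom_displacement[vx ax]] := vXi i k.
  by rewrite ax.
have [aXi /extended_atomE ->] := vXi i k.
exists (if v.1 i k == 0 then xihat i else atom xihat v i k) => //.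
by case: ifP.
Qed.

Lemma le_objectiveP v o : (forall i k, 0 <= v.1 i k) ->
  (o%:E <= objective xihat ell v)%E <->
  exists2 T : 'I_N -> 'I_K -> R,
    o <= N%:R^-1 * (\sum_(i < N) \sum_(k < K) T i k) &
    forall i k, ((T i k)%:E <= (v.1 i k)%:E * ell k (atom xihat v i k))%E.
Proof.
move=> v0; have N0 : 0 < N%:R :> R by rewrite ltr0n.
pose F i k := ((v.1 i k)%:E * ell k (atom xihat v i k))%E.
have Foo i k : (F i k < +oo)%E by rewrite perspective_lty.
have -> : objective xihat ell v = ((N%:R^-1)%:E * \sum_p F p.1 p.2)%E.
  rewrite /objective; congr (_ * _)%E.
  rewrite -(pair_bigA _ F)/= dsum_ltey => [|i]; last first.
    by rewrite (dsum_ltey (Foo i)); apply: lte_sum_pinfty.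
  by apply: eq_bigr => i _; rewrite (dsum_ltey (Foo i)).
have -> : (o%:E <= (N%:R^-1)%:E * \sum_p F p.1 p.2)%E =
    ((N%:R * o)%:E <= \sum_p F p.1 p.2)%E.
  rewrite -[in RHS](@lee_pmul2l _ (N%:R^-1)%:E)// ?lte_fin ?invr_gt0//.
  by rewrite -EFinM mulrA mulVf ?gt_eqF// mul1r.
split=> [/le_sum_realP[//|T oT FT]|[T oT TF]].
  exists (fun i k => T (i, k)).
    rewrite pair_bigA/= -(ler_pM2l N0) mulrA divff ?gt_eqF// mul1r.
    by under eq_bigr do rewrite -surjective_pairing.
  by move=> i k; rewrite -/(F i k) (FT (i, k)).
rewrite -(pair_bigA _ F)/=.
apply: (@le_trans _ _ (\sum_(i < N) \sum_(k < K) T i k)%:E).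
  rewrite lee_fin -(@ler_pM2l _ N%:R^-1) ?invr_gt0//.
  by rewrite mulrA mulVf ?gt_eqF// mul1r.
rewrite -sumEFin lee_sum// => i _.
by rewrite -sumEFin lee_sum.
Qed.

(** The combined decision puts its [(i, k)]-th atom at the barycenter of the two
    [(i, k)]-th atoms: displacements [q] then combine linearly, and perspectives
    lose nothing. Two budgets are allowed, so that this shows both that the
    program is convex and that its value is a concave function of the budget. *)
Lemma feasible_conv c1 c2 v1 v2 t : 0 <= t -> t <= 1 ->
  feasible nrm Xi xihat c1 v1 -> feasible nrm Xi xihat c2 v2 ->
  let v := t *: v1 + (1 - t) *: v2 in
  feasible nrm Xi xihat (t * c1 + (1 - t) * c2) v /\
  forall o1 o2, (o1%:E <= objective xihat ell v1)%E ->
    (o2%:E <= objective xihat ell v2)%E ->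
    ((t * o1 + (1 - t) * o2)%:E <= objective xihat ell v)%E.
Proof.
move=> t0 t1 /feasibleP[vc1 vs1 vp1 vX1] /feasibleP[vc2 vs2 vp2 vX2] v.
have N0 : 0 < N%:R :> R by rewrite ltr0n.
have t1' : 0 <= 1 - t by rewrite subr_ge0.
have v1E i k : v.1 i k = t * v1.1 i k + (1 - t) * v2.1 i k by rewrite !mxE.
have v2E i k : v.2 i k = t *: v1.2 i k + (1 - t) *: v2.2 i k by [].
clearbody v.
pose b i k := barycenter (xihat i) (t * v1.1 i k) ((1 - t) * v2.1 i k)
  (atom xihat v1 i k) (atom xihat v2 i k).
have vb i k : v.2 i k = v.1 i k *: (xihat i - b i k).
  rewrite v1E barycenterE ?mulr_ge0//.
  by rewrite v2E -!scalerA -(vX1 i k).2 -(vX2 i k).2.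
have bXi i k : Xi (b i k).
  rewrite /b /barycenter; case: ifPn => // s0.
  have [x1 _] := vX1 i k; have [x2 _] := vX2 i k.
  set a1 := t * _ in s0 *; set a2 := (1 - t) * _ in s0 *.
  have a10 : 0 <= a1 by rewrite mulr_ge0.
  have a20 : 0 <= a2 by rewrite mulr_ge0.
  have s0' : 0 < a1 + a2 by rewrite lt_neqAle eq_sym s0 addr_ge0.
  have -> : a2 / (a1 + a2) = 1 - a1 / (a1 + a2) by field.
  have u0 : 0 <= a1 / (a1 + a2) by rewrite divr_ge0// ltW.
  have u1 : a1 / (a1 + a2) <= 1 by rewrite ler_pdivrMr// mul1r lerDl.
  have u01 : Itv.spec (@Itv.num_sem R) (Itv.Real `[0%Z, 1%Z]) (a1 / (a1 + a2)).
    by rewrite /Itv.spec/=/Itv.num_sem num_real/= in_itv/= u0 u1.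
  by have := Xi_convex (Itv.mk u01) (mem_set x1) (mem_set x2); rewrite inE.
have aE i k := atomE (vb i k).
have vp i k : 0 <= v.1 i k by rewrite v1E addr_ge0// mulr_ge0.
split.
  apply/feasibleP; split => //.
  - apply: le_trans (lerD (ler_wpM2l t0 vc1) (ler_wpM2l t1' vc2)).
    rewrite !(mulrCA _ N%:R^-1) -mulrDr ler_wpM2l ?invr_ge0 ?ler0n//.
    rewrite !mulr_sumr -big_split ler_sum// => i _ /=.
    rewrite !mulr_sumr -big_split ler_sum// => k _ /=.
    rewrite v2E (le_trans (is_norm_triangle nrm_norm _ _))//.
    rewrite !(is_normZ nrm_norm).
    by rewrite !ger0_norm.
  - move=> i; under eq_bigr do rewrite v1E.
    by rewrite big_split/= -!mulr_sumr vs1 vs2; ring.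
  - move=> i k; split; first by rewrite aE; case: ifP.
    by rewrite aE vb; case: ifPn => // /eqP ->; rewrite !scale0r.
move=> o1 o2 /(le_objectiveP _ vp1)[T1 oT1 T1f].
move=> /(le_objectiveP _ vp2)[T2 oT2 T2f].
apply/(le_objectiveP _ vp); exists (fun i k => t * T1 i k + (1 - t) * T2 i k).
  apply: le_trans (lerD (ler_wpM2l t0 oT1) (ler_wpM2l t1' oT2)) _.
  rewrite !(mulrCA _ N%:R^-1) -mulrDr le_eqVlt; apply/orP; left; apply/eqP.
  congr (_ * _); rewrite !mulr_sumr -big_split/=.
  by apply: eq_bigr => i _; rewrite !mulr_sumr -big_split.
move=> i k; rewrite aE.
have scale s T a x : 0 <= s -> (T%:E <= a%:E * ell k x)%E ->
    ((s * T)%:E <= (s * a)%:E * ell k x)%E.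
  by move=> s0 Ta; rewrite !EFinM -muleA lee_wpmul2l.
have := perspective_superadditive (ell_proper k) (ell_convex k) (xihat i)
  (mulr_ge0 t0 (vp1 i k)) (mulr_ge0 t1' (vp2 i k))
  (scale _ _ _ _ t0 (T1f i k)) (scale _ _ _ _ t1' (T2f i k)).
rewrite -v1E -/(b i k) => /le_trans; apply.
by case: ifPn => // /eqP ->; rewrite !mul0e.
Qed.

End decisions.

(** * Concave values of a budget and their supporting lines *)

(** [G c o] stands for: value [o] can be reached with budget [c]. *)
Section supporting_line.
Context (R : realType) (G : R -> R -> Prop) (a A B eps : R).
Hypothesis G_conv : forall t c1 o1 c2 o2, 0 <= t -> t <= 1 ->
  G c1 o1 -> G c2 o2 -> G (t * c1 + (1 - t) * c2) (t * o1 + (1 - t) * o2).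
Hypothesis G_mono : forall c1 c2 o, c1 <= c2 -> G c1 o -> G c2 o.
Hypothesis G_growth : forall c o, G c o -> o <= A + B * c.
Hypothesis G_limit : forall u w : nat -> R, (forall n, G (u n) (w n)) ->
  u @ \oo --> eps -> (forall n, a <= w n) ->
  exists c o, [/\ G c o, c <= eps & c = eps -> a <= o].
Hypothesis G_dual : forall l, 0 <= l ->
  exists c o, G c o /\ a + l * (c - eps) < o.
Hypothesis B_ge0 : 0 <= B.

(** When no budget below [eps] reaches any value, steeper and steeper lines
    through [(eps, a)] yield points of [G] whose budgets decrease to [eps], and
    closedness of [G] at [eps] applies. *)
Lemma exists_left_point : ~ (exists2 o, G eps o & a <= o) ->
  exists c o, G c o /\ c < eps.
Proof.
move=> noG; apply: contrapT => noleft.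
have right c o : G c o -> eps <= c.
  by move=> Gco; rewrite leNgt; apply/negP => ceps; apply: noleft; exists c, o.
(* the offset B beats the growth rate of G and leaves the slope n + 1 *)
have /choice[u] : forall n : nat, exists c, exists o,
    G c o /\ a + (n.+1%:R + B) * (c - eps) < o.
  by move=> n; apply: G_dual; rewrite addr_ge0.
move=> /choice[w uw].
have u_ge n : eps <= u n by exact: right (uw n).1.
have ucvg : u @ \oo --> eps.
  pose D := A + B * eps - a.
  apply: (@squeeze_cvgr _ _ _ _ (cst eps) (fun n => eps + D * n.+1%:R^-1)).
  - apply: nearW => n; rewrite u_ge/= -lerBlDl.
    have [Guw auw] := uw n; have ow := G_growth Guw.
    rewrite ler_pdivlMr ?ltr0n// mulrC; move: auw ow; rewrite /D mulrDl; lra.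
  - exact: cvg_cst.
  - rewrite -[X in _ --> X]addr0; apply: cvgD; first exact: cvg_cst.
    rewrite -[X in _ --> X](mulr0 D); apply: cvgM; first exact: cvg_cst.
    exact: cvg_harmonic.
have aw n : a <= w n.
  have [_ /ltW] := uw n; apply: le_trans; rewrite lerDl mulr_ge0// ?subr_ge0//.
  by rewrite addr_ge0.
have [c [ o [Gco ceps ao]]] := G_limit (fun n => (uw n).1) ucvg aw.
have ceps' : c = eps by apply/eqP; rewrite eq_le ceps (right _ _ Gco).
by apply: noG; exists o; [rewrite -ceps'|exact: ao].
Qed.

(** Suppose that [G] stays strictly below [a] at [eps]. By convexity each slope
    from a point on the right of [eps] to [(eps, a)] is at most each slope from
    a point on the left, so no point of [G] lies strictly above the line through
    [(eps, a)] whose slope is the infimum of the latter. *)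
Lemma dual_attained : exists2 o, G eps o & a <= o.
Proof.
apply: contrapT => noG; have [c0 [ o0 [G0 ceps0]]] := exists_left_point noG.
have below o : G eps o -> o < a.
  by move=> Go; rewrite ltNge; apply/negP => ao; apply: noG; exists o.
pose S := [set l | exists c o, [/\ G c o, c < eps & l = (a - o) / (eps - c)]].
have cross c1 o1 c2 o2 : G c1 o1 -> G c2 o2 -> c1 < eps -> eps < c2 ->
    (o2 - a) / (c2 - eps) <= (a - o1) / (eps - c1).
  move=> G1 G2 c1e c2e.
  rewrite ler_pdivrMr ?subr_gt0// mulrAC ler_pdivlMr ?subr_gt0//.
  pose t := (c2 - eps) / (c2 - c1).
  have d0 : 0 < c2 - c1 by rewrite subr_gt0 (lt_trans c1e).
  have t0 : 0 <= t by rewrite divr_ge0 ?subr_ge0 ?ltW// (lt_trans c1e).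
  have t1 : t <= 1 by rewrite ler_pdivrMr// mul1r lerD2l lerN2 ltW.
  have teps : t * c1 + (1 - t) * c2 = eps by rewrite /t; field; rewrite gt_eqF.
  have := G_conv t0 t1 G1 G2; rewrite teps => /below.
  rewrite -(ltr_pM2r d0).
  have -> : (t * o1 + (1 - t) * o2) * (c2 - c1) =
      (c2 - eps) * o1 + (eps - c1) * o2.
    by rewrite /t; field; rewrite gt_eqF.
  by nra.
have S_ge0 : lbound S 0.
  move=> _ [c [ o [Gco ce ->]]]; rewrite divr_ge0// subr_ge0 ltW//.
  exact: below (G_mono (ltW ce) Gco).
have S_inf : has_inf S.
  by split; [exists ((a - o0) / (eps - c0)), c0, o0|exists 0].
have l0 : 0 <= inf S by apply: lb_le_inf => //; case: S_inf.
have [c [ o [Gco]]] := G_dual l0; rewrite ltNge => /negP; apply.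
rewrite -lerBlDl.
case: (ltrgtP c eps) => [ce|ce|ce].
- have : inf S <= (a - o) / (eps - c).
    by apply: (ge_inf S_inf.2); exists c, o.
  by rewrite ler_pdivlMr ?subr_gt0//; nra.
- rewrite -ler_pdivrMr ?subr_gt0//; apply: lb_le_inf; first by case: S_inf.
  by move=> _ [c1 [ o1 [G1 c1e ->]]]; exact: cross.
- by rewrite ce subrr mulr0 subr_le0 ltW// below// -ce.
Qed.

End supporting_line.

(** * Linear growth of upper semicontinuous concave functions *)

Section growth.
Context (R : realType) (m : nat) (nrm : 'rV[R]_m -> R) (f : 'rV[R]_m -> \bar R).
Hypothesis nrm_norm : is_norm nrm.
Hypothesis f_proper : proper_fun (fun x => - f x)%E.
Hypothesis f_convex : convex_efun setT (fun x => - f x)%E.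
Hypothesis f_usc : lower_semicontinuous (fun x => - f x)%E.

Lemma usc_near (x : 'rV[R]_m) (r : R) : (f x < r%:E)%E ->
  \forall y \near x, (f y < r%:E)%E.
Proof.
move=> fxr; have [|V Vx fV] := f_usc (x := x) (a := - r).
  by rewrite EFinN lteN2.
apply: (@filterS _ _ (nbhs_filter x) _ _ _ Vx) => y /fV.
by rewrite EFinN lteN2.
Qed.

(** A sequence along which [f] is unbounded would cluster at a point near which
    [f] is bounded. *)
Lemma usc_bounded (D : set 'rV[R]_m) : compact D ->
  exists M : R, forall x, D x -> (f x <= M%:E)%E.
Proof.
move=> cD; apply: contrapT => noM.
have /choice[u uP] : forall n : nat, exists x, D x /\ (n%:R%:E < f x)%E.
  move=> n; apply: contrapT => H; apply: noM; exists n%:R => x Dx.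
  by rewrite leNgt; apply/negP => fx; apply: H; exists x.
have [|p [Dp clp]] := cD (u @ \oo)%classic _.
  by exists 0%N => // n _ /=; exact: (uP n).1.
have [r fpr] : exists r : R, (f p < r%:E)%E.
  have := proper_lty f_proper p.
  case: (f p) => [z _||_]; [|by []|by exists 0; rewrite ltNyr].
  by exists (z + 1); rewrite lte_fin ltrDl.
have /clp/(_ (usc_near fpr)) : (u @ \oo)%classic [set x | (r%:E < f x)%E].
  apply: filterS (nbhs_infty_gtr r) => n /= rn; apply: lt_trans (uP n).2.
  by rewrite lte_fin.
by move=> [x /= [/lt_trans /[apply]]]; rewrite ltxx.
Qed.

(** Concavity propagates an upper bound on a ball around a point of the
    effective domain to an affine bound outside of this ball. *)
Lemma linear_growth : exists A B : R, [/\ 0 <= A, 0 <= B &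
  forall x, (f x <= (A + B * nrm x)%:E)%E].
Proof.
have [C C0 mxC] := mx_le_is_norm nrm_norm.
have [r [x0 fx0]] : exists r x0, f x0 = r%:E.
  have [[x fx] _] := f_proper; have := proper_lty f_proper x.
  by move: fx; case fxE : (f x) => [r||]// _ _; exists r, x.
have [M0 fM0] := usc_bounded (@compact_mx_ball R m (`|x0| + 1)).
pose M := `|M0|; have M_ge0 : 0 <= M by exact: normr_ge0.
have fM x : `|x| <= `|x0| + 1 -> (f x <= M%:E)%E.
  by move=> /fM0 /le_trans; apply; rewrite lee_fin ler_norm.
have r_ge0 := normr_ge0 r.
exists (M + (M + `|r|) * `|x0|), ((M + `|r|) * C); split.
- by rewrite addr_ge0// mulr_ge0// addr_ge0.
- by rewrite mulr_ge0// addr_ge0.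
move=> x; pose s := `|x - x0|.
suff : (f x <= (M + (M + `|r|) * s)%:E)%E.
  move=> /le_trans; apply; rewrite lee_fin -addrA -[X in _ + (_ + X)]mulrA.
  rewrite -mulrDr lerD2l.
  rewrite ler_wpM2l ?addr_ge0// (le_trans (ler_normB _ _))// addrC lerD2l.
  by rewrite mxC.
have [s1|s1] := leP s 1.
  apply: (@le_trans _ _ M%:E).
    apply: fM; rewrite -[x](subrK x0) (le_trans (ler_normD _ _))// addrC.
    by rewrite lerD2l.
  by rewrite lee_fin lerDl mulr_ge0 ?addr_ge0// normr_ge0.
have s0 : 0 < s by rewrite (lt_trans _ s1).
have si0 : 0 <= s^-1 by rewrite invr_ge0 ltW.
have si1 : s^-1 <= 1 by rewrite invf_le1// ltW.
have fx0' : (r%:E <= f x0)%E by rewrite fx0.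
(* y is the point of the segment from x0 to x at distance 1 of x0 *)
pose y := s^-1 *: x + (1 - s^-1) *: x0.
have yM : (f y <= M%:E)%E.
  apply: fM; have -> : y = s^-1 *: (x - x0) + x0.
    by rewrite /y scalerBr scalerBl scale1r addrCA addrC.
  rewrite (le_trans (ler_normD _ _))// addrC lerD2l normrZ ger0_norm//.
  by rewrite mulVf// gt_eqF.
case fxE : (f x) => [z||]; last 2 first.
- by have := proper_lty f_proper x; rewrite fxE.
- by rewrite leNye.
have zx : (z%:E <= f x)%E by rewrite fxE.
have := le_trans (concave_real f_proper f_convex si0 si1 zx fx0') yM.
rewrite !lee_fin => H.
have {}H : z + (s - 1) * r <= M * s.
  have -> : z + (s - 1) * r = (s^-1 * z + (1 - s^-1) * r) * s.
    by field; rewrite gt_eqF.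
  by rewrite ler_wpM2r// ltW.
have := ler_norm (- r); rewrite normrN; nra.
Qed.

End growth.

(** * Values reached by decisions of a given budget *)

Section attainable_values.
Context (R : realType) (m N K : nat).
Variables (nrm : 'rV[R]_m -> R) (Xi : set 'rV[R]_m).
Variables (xihat : 'I_N -> 'rV[R]_m) (ell : 'I_K -> 'rV[R]_m -> \bar R).
Hypotheses (N_gt0 : (0 < N)%N) (nrm_norm : is_norm nrm).
Hypothesis (Xi_convex : convex_set Xi).
Hypothesis xihat_Xi : forall i, Xi (xihat i).
Hypothesis ell_proper : forall k, proper_fun (fun x => - ell k x)%E.
Hypothesis ell_convex : forall k, convex_efun setT (fun x => - ell k x)%E.
Hypothesis ell_lsc : forall k, lower_semicontinuous (fun x => - ell k x)%E.
Implicit Types (v : decision R m N K) (c o t : R).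

(** The points below the graph of the optimal value as a function of the budget,
    except those that a supremum only approaches. *)
Definition attainable c o := exists2 v,
  feasible nrm Xi xihat c v & (o%:E <= objective xihat ell v)%E.

Lemma attainable_conv t c1 o1 c2 o2 : 0 <= t -> t <= 1 ->
  attainable c1 o1 -> attainable c2 o2 ->
  attainable (t * c1 + (1 - t) * c2) (t * o1 + (1 - t) * o2).
Proof.
move=> t0 t1 [v1 fv1 ov1] [v2 fv2 ov2].
have [fv ov] := feasible_conv N_gt0 nrm_norm Xi_convex xihat_Xi
  ell_proper ell_convex t0 t1 fv1 fv2.
by exists (t *: v1 + (1 - t) *: v2) => //; exact: ov.
Qed.

Lemma attainable_mono c1 c2 o : c1 <= c2 -> attainable c1 o -> attainable c2 o.
Proof.
move=> c12 [v /(feasibleP _ xihat_Xi)[vc v1 v0 vX] ov]; exists v => //.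
by apply/(feasibleP _ xihat_Xi); split => //; exact: le_trans c12.
Qed.

Lemma attainable_plan (al : 'I_N -> 'I_K -> R) (x : 'I_N -> 'I_K -> 'rV[R]_m)
    (T : 'I_N -> 'I_K -> R) :
  (forall i k, 0 <= al i k) -> (forall i, \sum_k al i k = 1) ->
  (forall i k, Xi (x i k)) ->
  (forall i k, ((T i k)%:E <= (al i k)%:E * ell k (x i k))%E) ->
  attainable (N%:R^-1 * (\sum_i \sum_k al i k * nrm (xihat i - x i k)))
    (N%:R^-1 * (\sum_i \sum_k T i k)).
Proof.
move=> al0 al1 xXi Tal.
pose v : decision R m N K :=
  (\matrix_(i, k) al i k, fun i k => al i k *: (xihat i - x i k)).
have v1E i k : v.1 i k = al i k by rewrite mxE.
have v2E i k : v.2 i k = v.1 i k *: (xihat i - x i k) by rewrite v1E.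
have aE i k := atomE (v2E i k).
have v0 i k : 0 <= v.1 i k by rewrite v1E.
exists v.
  apply/(feasibleP _ xihat_Xi); split => //.
  - rewrite ler_wpM2l ?invr_ge0// ler_sum// => i _; rewrite ler_sum// => k _.
    by rewrite v2E v1E (is_normZ nrm_norm) ger0_norm.
  - by move=> i; under eq_bigr do rewrite v1E.
  - move=> i k; rewrite aE; case: ifPn => [/eqP va0|_]; last by split.
    by split => //; rewrite v2E va0 !scale0r.
apply/(le_objectiveP _ N_gt0 ell_proper _ v0); exists T => // i k.
rewrite aE v1E (le_trans (Tal i k))//; case: ifPn => // /eqP ->.
by rewrite !mul0e.
Qed.

(** The bound is stated on the displacement [al *: (xihat i - x)], not on the
    point [x]: it stays meaningful when [al] tends to [0] while [x] escapes to
    infinity. *)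
Lemma piece_growth : exists A B : R, [/\ 0 <= A, 0 <= B &
  forall i k al x T, 0 <= al -> (T%:E <= al%:E * ell k x)%E ->
    T <= A * al + B * nrm (al *: (xihat i - x))].
Proof.
have /choice[A /choice[B AB]] : forall k, exists A B : R, [/\ 0 <= A, 0 <= B &
    forall x, (ell k x <= (A + B * nrm x)%:E)%E].
  by move=> k; exact: linear_growth.
have nrm0 := is_norm_ge0 nrm_norm.
have sA0 : 0 <= \sum_k A k by apply: sumr_ge0 => k _; case: (AB k).
have sB0 : 0 <= \sum_k B k by apply: sumr_ge0 => k _; case: (AB k).
have sX0 : 0 <= \sum_i nrm (xihat i) by apply: sumr_ge0 => i _.
exists (\sum_k A k + (\sum_k B k) * (\sum_i nrm (xihat i))), (\sum_k B k).
split => //; first by rewrite addr_ge0// mulr_ge0.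
move=> i k al x T al0 Tal.
have [A0 B0 /(_ x) ellx] := AB k.
have : (T%:E <= (al * (A k + B k * nrm x))%:E)%E.
  by rewrite (le_trans Tal)// EFinM lee_wpmul2l.
rewrite lee_fin => /le_trans; apply.
rewrite (is_normZ nrm_norm) ger0_norm// mulrCA (mulrC _ al) -mulrDr ler_wpM2l//.
rewrite -addrA lerD//.
  by rewrite (bigD1 k)//= lerDl sumr_ge0// => j _; case: (AB j).
rewrite -mulrDr ler_pM//.
  by rewrite (bigD1 k)//= lerDl sumr_ge0// => j _; case: (AB j).
have : nrm x <= nrm (xihat i) + nrm (xihat i - x).
  rewrite -(is_normN nrm_norm (xihat i - x)).
  rewrite (le_trans _ (is_norm_triangle nrm_norm _ _))//.
  by rewrite opprB addrC subrK.
move=> /le_trans; apply; rewrite lerD2r (bigD1 i)//= lerDl.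
by rewrite sumr_ge0.
Qed.

Lemma attainable_growth (A B : R) : 0 <= B ->
  (forall i k al x T, 0 <= al -> (T%:E <= al%:E * ell k x)%E ->
    T <= A * al + B * nrm (al *: (xihat i - x))) ->
  forall c o, attainable c o -> o <= A + B * c.
Proof.
move=> B0 AB c o [v /(feasibleP _ xihat_Xi)[vc v1 v0 vX]].
have N0 : 0 < N%:R :> R by rewrite ltr0n.
move=> /(le_objectiveP _ N_gt0 ell_proper _ v0)[T oT Tv].
apply: (@le_trans _ _ (A + B *
  (N%:R^-1 * (\sum_(i < N) \sum_(k < K) nrm (v.2 i k))))); last first.
  by rewrite lerD2l ler_wpM2l.
apply: (le_trans oT); rewrite -(ler_pM2l N0) mulrA divff ?gt_eqF// mul1r mulrDr.
rewrite mulrCA [X in B * X]mulrA divff ?gt_eqF// mul1r.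
have -> : N%:R * A = \sum_(i < N) \sum_(k < K) A * v.1 i k.
  under eq_bigr do rewrite -mulr_sumr v1 mulr1.
  by rewrite sumr_const card_ord mulr_natl.
rewrite mulr_sumr -big_split ler_sum// => i _.
rewrite mulr_sumr -big_split ler_sum// => k _ /=.
rewrite [v.2 i k](vX i k).2; exact: AB.
Qed.

End attainable_values.

(** * Limits of attainable values *)

Section ultrafilter_limits.
Context (R : realType) (m : nat) (U : set_system nat).
Hypothesis U_ultra : UltraFilter U.

(** Along one fixed ultrafilter all components of a bounded sequence of
    decisions converge at once, without extracting successive subsequences. *)
Lemma ultra_compact_cvg (T : topologicalType) (D : set T) (u : nat -> T) :
  compact D -> (forall n, D (u n)) -> exists2 l, D l & u @ U --> l.
Proof.
move=> cD uD.
have uU : UltraFilter (u @ U)%classic.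
  split; first exact: fmap_proper_filter.
  move=> G FG UG; rewrite eqEsubset; split => // A GA.
  have [//|UA] := in_ultra_setVsetC (u @^-1` A) U_ultra.
  have /(filterI GA) : G (~` A) by exact: UG.
  by rewrite setICr => /filter_not_empty.
have uDU : (u @ U)%classic D.
  by apply: (@filterS _ U _ setT) => [n _ /=|]; [exact: uD|exact: filterT].
have := cD; rewrite compact_ultra => /(_ _ uU uDU)[l [Dl ul]].
by exists l.
Qed.

Lemma ultra_bounded_cvg (u : nat -> R) (a b : R) :
  (forall n, a <= u n <= b) -> exists l : R, u @ U --> l.
Proof.
move=> uab.
have [|l _ ul] := ultra_compact_cvg (@segment_compact _ a b) (u := u).
  by move=> n /=; rewrite in_itv/= uab.
by exists l.
Qed.

End ultrafilter_limits.

Lemma le_sum_bounded_below (R : realDomainType) (I : finType) (T : I -> R)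
    (a M : R) :
  a <= \sum_i T i -> (forall i, T i <= M) ->
  forall i, a - #|I|%:R * `|M| <= T i.
Proof.
move=> aT TM i; rewrite lerBlDr (le_trans aT)// (bigD1 i)//= lerD2l.
apply: (@le_trans _ _ (\sum_(j | j != i) `|M|)).
  by apply: ler_sum => j _; rewrite (le_trans (TM j))// ler_norm.
by rewrite sumr_const -[leLHS]mulr_natl ler_wpM2r// ler_nat max_card.
Qed.

Section attainable_limit.
Context (R : realType) (m N K : nat).
Variables (nrm : 'rV[R]_m -> R) (Xi : set 'rV[R]_m).
Variables (xihat : 'I_N -> 'rV[R]_m) (ell : 'I_K -> 'rV[R]_m -> \bar R).
Hypotheses (N_gt0 : (0 < N)%N) (nrm_norm : is_norm nrm).
Hypothesis (Xi_closed : closed Xi).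
Hypothesis xihat_Xi : forall i, Xi (xihat i).
Hypothesis ell_proper : forall k, proper_fun (fun x => - ell k x)%E.
Hypothesis ell_lsc : forall k, lower_semicontinuous (fun x => - ell k x)%E.
Implicit Types (v : decision R m N K) (c o t : R).

Section along_ultrafilter.
Variables (U : set_system nat).
Hypothesis U_ultra : UltraFilter U.

(** As the limit mass [al'] is positive, the points [x n] converge to [x'], and
    upper semicontinuity bounds the limit of the terms [T n]. *)
Lemma piece_limit k (z : 'rV[R]_m) (al T : nat -> R) (x : nat -> 'rV[R]_m)
    (al' T' : R) (q' : 'rV[R]_m) :
  (forall n, Xi (x n)) -> (forall n, 0 <= al n) ->
  (forall n, ((T n)%:E <= (al n)%:E * ell k (x n))%E) ->
  al @ U --> al' -> T @ U --> T' ->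
  (fun n => al n *: (z - x n)) @ U --> q' -> 0 < al' ->
  let x' := z - al'^-1 *: q' in
  Xi x' /\ (T'%:E <= al'%:E * ell k x')%E.
Proof.
move=> xXi al0 Tx alU TU qU al'0 x'.
have alU0 : \forall n \near U, 0 < al n by exact: (cvgr_gt al').
have xU : x @ U --> x'.
  have : (fun n => z - (al n)^-1 *: (al n *: (z - x n))) @ U --> x'.
    apply: cvgB; first exact: cvg_cst.
    by apply: cvgZ => //; apply: cvgV => //; rewrite gt_eqF.
  apply: cvg_trans; apply: near_eq_cvg; apply: filterS alU0 => n aln.
  by rewrite scalerA mulVf ?gt_eqF// scale1r subKr.
split.
  by apply: (@closed_cvg _ _ U _ x Xi Xi_closed _ x' xU); exact: nearW.
rewrite leNgt; apply/negP => H.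
have [r r1 r2] : exists2 r : R, (ell k x' < r%:E)%E & al' * r < T'.
  have := proper_lty (ell_proper k) x'; move: H.
  case: (ell k x') => [e||]//.
    rewrite -EFinM lte_fin => H _; exists ((e + T' / al') / 2).
      rewrite lte_fin ltr_pdivlMr// mulr_natr mulr2n ltrD2l.
      by rewrite ltr_pdivlMr// mulrC.
    have -> : al' * ((e + T' / al') / 2) = (al' * e + T') / 2.
      by field; rewrite gt_eqF.
    by rewrite ltr_pdivrMr// mulr_natr mulr2n ltrD2r.
  move=> _ _; exists ((T' - 1) / al'); first by rewrite ltNyr.
  by rewrite mulrCA divff ?gt_eqF// mulr1 ltrBlDr ltrDl.
have near_r : \forall n \near U, (ell k (x n) < r%:E)%E.
  exact: (xU _ (usc_near (@ell_lsc k) r1)).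
have : T' <= al' * r.
  have alr : (fun n => al n * r) @ U --> al' * r.
    by apply: cvgM; [exact: alU|exact: cvg_cst].
  apply: (ler_cvg_to TU alr); apply: filterS near_r => n /ltW elln.
  by rewrite -lee_fin (le_trans (Tx n))// EFinM lee_wpmul2l// lee_fin.
by rewrite leNgt r2.
Qed.

End along_ultrafilter.

(** The limit decision keeps the pieces whose mass stays positive. A piece whose
    mass vanishes may escape to infinity; it is dropped, which forfeits at most
    [B] times the budget that it was using. So if the limit decision spends all
    of [eps], nothing was forfeited. *)
Lemma attainable_limit (A B : R) (eps a : R) (u w : nat -> R) :
  0 <= A -> 0 <= B ->
  (forall i k al x T, 0 <= al -> (T%:E <= al%:E * ell k x)%E ->
    T <= A * al + B * nrm (al *: (xihat i - x))) ->
  (forall n, attainable nrm Xi xihat ell (u n) (w n)) ->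
  u @ \oo --> eps -> (forall n, a <= w n) ->
  exists c o, [/\ attainable nrm Xi xihat ell c o, c <= eps &
    c = eps -> a <= o].
Proof.
move=> A0 B0 AB uw ueps aw.
have N0 : 0 < N%:R :> R by rewrite ltr0n.
have nrm0 := is_norm_ge0 nrm_norm.
have /choice[v vP] : forall n, exists v : decision R m N K,
    feasible nrm Xi xihat (u n) v /\ ((w n)%:E <= objective xihat ell v)%E.
  by move=> n; have [v fv wv] := uw n; exists v.
have fv n := (feasibleP _ xihat_Xi _ _).1 (vP n).1.
pose al n i k := (v n).1 i k; pose q n i k := (v n).2 i k.
pose x n i k := atom xihat (v n) i k.
have al_ge0 n i k : 0 <= al n i k by have [_ _ + _] := fv n; apply.
have al_sum n i : \sum_k al n i k = 1 by have [_ + _ _] := fv n; apply.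
have al_le1 n i k : al n i k <= 1.
  by rewrite -(al_sum n i) (bigD1 k)//= lerDl sumr_ge0.
have xXi n i k : Xi (x n i k) by have [_ _ _ +] := fv n; move=> /(_ i k)[].
have qE n i k : q n i k = al n i k *: (xihat i - x n i k).
  by have [_ _ _ +] := fv n; move=> /(_ i k)[].
have cost n : N%:R^-1 * (\sum_i \sum_k nrm (q n i k)) <= u n by have [] := fv n.
have /choice[T TP] : forall n, exists T : 'I_N -> 'I_K -> R,
    w n <= N%:R^-1 * (\sum_i \sum_k T i k) /\
    forall i k, ((T i k)%:E <= (al n i k)%:E * ell k (x n i k))%E.
  move=> n; have [T ? ?] :=
    (le_objectiveP _ N_gt0 ell_proper _ (al_ge0 n)).1 (vP n).2.
  by exists T.
have TAB n i k : T n i k <= A * al n i k + B * nrm (q n i k).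
  by rewrite qE; apply: AB => //; exact: (TP n).2.
have [C uC] : exists C, forall n, u n <= C.
  have [M [_ uM]] := cvg_seq_bounded (cvgP _ ueps); exists (M + 1) => n.
  rewrite (le_trans (ler_norm _))//; apply: (uM (M + 1)); last by [].
  by rewrite ltrDl.
have nqC n i k : nrm (q n i k) <= N%:R * C.
  have : \sum_i \sum_k nrm (q n i k) <= N%:R * C.
    by rewrite -ler_pdivrMl// (le_trans (cost n)).
  apply: le_trans; rewrite (bigD1 i)//= (bigD1 k)//= -addrA lerDl addr_ge0//.
    by apply: sumr_ge0.
  by apply: sumr_ge0 => j _; apply: sumr_ge0.
have TM n i k : T n i k <= A + B * (N%:R * C).
  by rewrite (le_trans (TAB n i k))// lerD// ?ler_piMr// ler_wpM2l.
have sumT n : N%:R * a <= \sum_i \sum_k T n i k.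
  by rewrite -ler_pdivlMl// (le_trans (aw n))// (TP n).1.
(* the sum is bounded below and the other terms are bounded above *)
have Tm n i k :
    N%:R * a - #|{: 'I_N * 'I_K}|%:R * `|A + B * (N%:R * C)| <= T n i k.
  apply: (@le_sum_bounded_below _ _ (fun p => T n p.1 p.2)
    _ _ _ _ (i, k)) => //.
  by rewrite -(pair_bigA _ (T n)).
have [U [UU oU]] := ultraFilterLemma (eventually_filter).
have [C' C'0 mxC] := mx_le_is_norm nrm_norm.
have al_cvg i k : {l : R | (fun n => al n i k) @ U --> l}.
  apply: cid; apply: (ultra_bounded_cvg UU (a := 0) (b := 1)) => n.
  by rewrite al_ge0 al_le1.
have T_cvg i k : {l : R | (fun n => T n i k) @ U --> l}.
  apply: cid; apply: (ultra_bounded_cvg UU (u := fun n => T n i k)) => n.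
  by apply/andP; split; [exact: Tm|exact: TM].
have q_cvg i k : {l : 'rV[R]_m | (fun n => q n i k) @ U --> l}.
  apply: cid; have [|l _ ul] := ultra_compact_cvg UU
    (@compact_mx_ball R m (C' * (N%:R * C))) (u := fun n => q n i k).
    by move=> n; rewrite /= (le_trans (mxC _))// ler_wpM2l.
  by exists l.
pose al' i k := sval (al_cvg i k); pose T' i k := sval (T_cvg i k).
pose q' i k := sval (q_cvg i k).
have alU i k : (fun n => al n i k) @ U --> al' i k := svalP (al_cvg i k).
have TU i k : (fun n => T n i k) @ U --> T' i k := svalP (T_cvg i k).
have qU i k : (fun n => q n i k) @ U --> q' i k := svalP (q_cvg i k).
have nqU i k : (fun n => nrm (q n i k)) @ U --> nrm (q' i k).
  apply: (@continuous_cvg _ _ _ U _ (fun n => q n i k) nrm) => //.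
  exact: (is_norm_continuous nrm_norm).
have uU : u @ U --> eps by apply: cvg_trans ueps; exact: cvg_app.
have al'_ge0 i k : 0 <= al' i k.
  by apply: (cvgr_to_ge (alU i k)); exact: nearW.
have al'_sum i : \sum_k al' i k = 1.
  have sumU : (fun n => \sum_k al n i k) @ U --> \sum_k al' i k.
    by apply: cvg_big => //; exact: add_continuous.
  have oneU : (fun n => \sum_k al n i k) @ U --> (1 : R).
    by apply: cvg_near_cst; apply: nearW => n; exact: al_sum.
  exact: (@norm_cvg_unique _ _ _ _ _ _ sumU oneU).
have cost' : N%:R^-1 * (\sum_i \sum_k nrm (q' i k)) <= eps.
  apply: (@ler_cvg_to _ U _ _
    (fun n => N%:R^-1 * (\sum_i \sum_k nrm (q n i k))) _ _ _ _ uU).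
    apply: cvgM; first exact: cvg_cst.
    apply: cvg_big => [|i _]; first exact: add_continuous.
    by apply: cvg_big => //; exact: add_continuous.
  exact: nearW.
have sumT' : N%:R * a <= \sum_i \sum_k T' i k.
  apply: (@cvgr_to_ge _ U _ _ (fun n => \sum_i \sum_k T n i k)); last first.
    exact: nearW.
  apply: cvg_big => [|i _]; first exact: add_continuous.
  by apply: cvg_big => //; exact: add_continuous.
have T'AB i k : T' i k <= A * al' i k + B * nrm (q' i k).
  apply: (@ler_cvg_to _ U _ _ _
    (fun n => A * al n i k + B * nrm (q n i k)) _ _ (TU i k)).
    by apply: cvgD; apply: cvgM;
      [exact: cvg_cst|exact: alU|exact: cvg_cst|exact: nqU].
  exact: nearW.
pose x' i k :=
  if al' i k == 0 then xihat i else xihat i - (al' i k)^-1 *: q' i k.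
pose T'' i k := if al' i k == 0 then 0 else T' i k.
have lim i k : 0 < al' i k -> Xi (xihat i - (al' i k)^-1 *: q' i k) /\
    ((T' i k)%:E <= (al' i k)%:E * ell k (xihat i - (al' i k)^-1 *: q' i k))%E.
  move=> al'0; apply: (piece_limit UU (z := xihat i) (al := fun n => al n i k)
    (T := fun n => T n i k) (x := fun n => x n i k)) => //.
  - by move=> n; exact: (TP n).2.
  - by have := qU i k; under eq_fun do rewrite qE.
have al'_gt0 i k : al' i k != 0 -> 0 < al' i k.
  by move=> al'0; rewrite lt_neqAle eq_sym al'0 al'_ge0.
have x'Xi i k : Xi (x' i k).
  by rewrite /x'; case: ifPn => // /al'_gt0/lim[].
have T''_le i k : ((T'' i k)%:E <= (al' i k)%:E * ell k (x' i k))%E.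
  rewrite /x' /T''; case: ifPn => [/eqP ->|/al'_gt0/lim[]//].
  by rewrite mul0e.
have := attainable_plan N_gt0 nrm_norm xihat_Xi ell_proper
  al'_ge0 al'_sum x'Xi T''_le.
set c := N%:R^-1 * _; set o := N%:R^-1 * _ => Gco.
have spent i k : al' i k * nrm (xihat i - x' i k) =
    if al' i k == 0 then 0 else nrm (q' i k).
  rewrite /x'; case: ifPn => [/eqP->|al'0]; first by rewrite mul0r.
  rewrite subKr (is_normZ nrm_norm) ger0_norm ?invr_ge0// mulrA divff// mul1r.
  by [].
have ceps : c <= eps.
  apply: le_trans cost'; rewrite ler_wpM2l ?invr_ge0//.
  apply: ler_sum => i _; apply: ler_sum => k _; rewrite spent.
  by case: ifP.
exists c, o; split => // ceq.
(* a dropped piece was worth at most B times its displacement, by T'AB *)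
have gap : \sum_i \sum_k T' i k <= \sum_i \sum_k T'' i k +
    B * (\sum_i \sum_k nrm (q' i k) -
         \sum_i \sum_k al' i k * nrm (xihat i - x' i k)).
  rewrite -sumrB mulr_sumr -big_split ler_sum//= => i _.
  rewrite -sumrB mulr_sumr -big_split ler_sum//= => k _.
  rewrite spent /T''; case: ifPn => [/eqP al0|_]; last first.
    by rewrite subrr mulr0 addr0.
  by rewrite subr0 add0r (le_trans (T'AB i k))// al0 mulr0 add0r.
rewrite /o -(ler_pM2l N0) mulrA divff ?gt_eqF// mul1r.
rewrite (le_trans sumT')// (le_trans gap)// gerDl mulr_ge0_le0// subr_le0.
by rewrite -(@ler_pM2l _ N%:R^-1) ?invr_gt0// -/c ceq.
Qed.

End attainable_limit.

(** * Integrals against discrete distributions *)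

Section integral_bounds.
Local Open Scope ereal_scope.
Context d (T : measurableType d) (R : realType).
Variable mu : {measure set T -> \bar R}.
Variable D : set T.
Implicit Types f g : T -> \bar R.

(** A nonnegative integral is the supremum of the integrals of the simple
    functions below the integrand, hence monotone for arbitrary integrands such
    as the transport cost [nrm (x - y)] on a product sigma-algebra. *)
Lemma ge0_le_integral_unmeasurable f g : (forall x, D x -> 0 <= f x) ->
  (forall x, D x -> f x <= g x) ->
  \int[mu]_(x in D) f x <= \int[mu]_(x in D) g x.
Proof.
move=> f0 fg; have g0 x (Dx : D x) : 0 <= g x := le_trans (f0 x Dx) (fg x Dx).
rewrite !ge0_integralE//; apply: le_ereal_sup => _ [h hf <-].
exists h => // x; rewrite (le_trans (hf x))// !patchE; case: ifPn => //.
by rewrite inE => /fg.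
Qed.

Lemma ge0_integral_le_scaled (l : R) f g : measurable D -> measurable_fun D f ->
  (0 <= l)%R -> (forall x, D x -> 0 <= f x) -> (forall x, D x -> 0 <= g x) ->
  (forall x, D x -> f x <= l%:E * g x) ->
  \int[mu]_(x in D) f x <= l%:E * \int[mu]_(x in D) g x.
Proof.
move=> mD mf; rewrite le0r => /orP[/eqP ->|l0] f0 g0 fg.
  rewrite mul0e (eq_integral (cst 0)) ?integral_cst ?mul0e// => x /[!inE] Dx.
  by apply/eqP; rewrite eq_le f0// andbT (le_trans (fg x Dx))// mul0e.
have l0' := ltW l0; rewrite -(@lee_pmul2l _ l^-1%:E) ?lte_fin ?invr_gt0// muleA.
rewrite -EFinM mulVf ?gt_eqF// mul1e -ge0_integralZl_EFin ?invr_ge0//.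
apply: ge0_le_integral_unmeasurable => x Dx.
  by rewrite mule_ge0 ?f0// lee_fin invr_ge0.
rewrite -(@lee_pmul2l _ l%:E) ?lte_fin// muleA -EFinM divff ?gt_eqF// mul1e.
exact: fg.
Qed.

End integral_bounds.

Section discrete_integral.
Local Open Scope ereal_scope.
Context d (T : measurableType d) (R : realType) (I : finType).
Variables (w : I -> R) (x : I -> T).
Variables (w_ge0 : forall i, (0 <= w i)%R) (w_sum1 : (\sum_i w i = 1)%R).
Local Notation mu := (discrete_distribution x w_ge0 w_sum1).
Implicit Types f : T -> \bar R.

Lemma ge0_integral_discrete f : measurable_fun setT f -> (forall t, 0 <= f t) ->
  \int[mu]_t f t = \sum_i (w i)%:E * f (x i).
Proof.
move=> mf f0.
have [i0 _|I0] := pickP (@predT I); last first.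
  by exfalso; move: w_sum1 => /eqP; rewrite big_pred0// eq_sym oner_eq0.
pose nu (n : nat) := mscale (NngNum (w_ge0 (nth i0 (index_enum I) n)))
  (\d_(x (nth i0 (index_enum I) n))).
(* nth enumerates the finite type I, as msum adds a sequence of measures *)
rewrite (eq_measure_integral (msum nu (size (index_enum I)))); last first.
  move=> A mA _; transitivity (\sum_i (w i)%:E * \d_(x i) A); first by [].
  rewrite /msum (big_nth i0) big_mkord.
  by apply: eq_bigr.
rewrite ge0_integral_measure_sum// [RHS](big_nth i0) big_mkord.
apply: eq_bigr => n _; rewrite ge0_integral_mscale// integral_dirac//.
by rewrite diracT mul1e.
Qed.

Import HBNNSimple.

(** Simple functions lie below [f], and the formula for them gives the bound
    for an arbitrary [f]. *)
Lemma ge0_integral_discrete_le f : (forall t, 0 <= f t) ->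
  \int[mu]_t f t <= \sum_i (w i)%:E * f (x i).
Proof.
move=> f0; rewrite ge0_integralTE//; apply: ge_ereal_sup => _ [h hf <-].
rewrite -integralT_nnsfun ge0_integral_discrete//; last 2 first.
  - by apply/measurable_EFinP; exact: measurable_funPT.
  - by move=> t; rewrite lee_fin; exact: fun_ge0.
by apply: lee_sum => i _; rewrite lee_wpmul2l// lee_fin.
Qed.

Lemma integrable_discrete (s : T -> R) : measurable_fun setT s ->
  mu.-integrable setT (EFin \o s).
Proof.
move=> ms; apply/integrableP; split; first exact/measurable_EFinP.
rewrite ge0_integral_discrete//; last first.
  by apply: measurableT_comp => //; exact/measurable_EFinP.
by apply: lte_sum_pinfty => i _; rewrite -EFinM ltry.
Qed.

Lemma integral_discrete (s : T -> R) : measurable_fun setT s ->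
  \int[mu]_t (s t)%:E = (\sum_i w i * s (x i))%:E.
Proof.
move=> ms; have mEs : measurable_fun setT (EFin \o s) by exact/measurable_EFinP.
rewrite integralE !ge0_integral_discrete//; last 2 first.
- exact: measurable_funeneg.
- exact: measurable_funepos.
have posE t : (EFin \o s)^\+ t = (Num.max (s t) 0)%:E.
  by rewrite funeposE /= EFin_max.
have negE t : (EFin \o s)^\- t = (Num.max (- s t) 0)%:E.
  by rewrite funenegE /= EFin_max.
under eq_bigr do rewrite posE -EFinM.
under [X in _ - X]eq_bigr do rewrite negE -EFinM.
rewrite !sumEFin -EFinB -sumrB; congr _%:E; apply: eq_bigr => i _.
rewrite -mulrBr; congr (_ * _)%R.
by have [s0|s0] := leP 0%R (s (x i)); [rewrite max_r ?subr0// oppr_le0|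
  rewrite max_l ?sub0r ?opprK// oppr_ge0 ltW].
Qed.

Lemma eexpectation_discrete f :
  measurable_fun setT f -> (forall t, f t < +oo) ->
  eexpectation mu f = \sum_i (w i)%:E * f (x i).
Proof.
move=> mf foo; rewrite /eexpectation.
have -> : \int[mu]_t maxe (f t) 0 = \sum_i (w i)%:E * maxe (f (x i)) 0.
  rewrite ge0_integral_discrete//; first exact: measurable_maxe.
  by move=> t; rewrite le_max lexx orbT.
have -> : \int[mu]_t mine (f t) 0 = \sum_i (w i)%:E * mine (f (x i)) 0.
  have minE t : mine (f t) 0 = - maxe (- f t) 0.
    by rewrite -[in LHS](oppeK (f t)) -[X in mine _ X]oppe0 -oppe_max.
  have m0 t : 0 <= maxe (- f t) 0 by rewrite le_max lexx orbT.
  under eq_integral do rewrite minE.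
  rewrite integral_ge0N// ge0_integral_discrete//; last first.
    by apply: measurable_maxe => //; exact: measurableT_comp.
  rewrite -sumeN => [|i j _ _]; last first.
    by rewrite ge0_adde_def// inE mule_ge0// lee_fin.
  by apply: eq_bigr => i _; rewrite minE muleN.
have fin_pos : \sum_i (w i)%:E * maxe (f (x i)) 0 \is a fin_num.
  apply/sum_fin_numP => i _; rewrite fin_numM// ge0_fin_numE.
    by rewrite gt_max foo ltry.
  by rewrite le_max lexx orbT.
rewrite DualAddTheoryNumDomain.dual_addeE_def ?fin_num_adde_defr//.
rewrite -big_split; apply: eq_bigr => i _ /=.
have [f0|f0] := leP 0 (f (x i)); first by rewrite mule0 adde0.
by rewrite mule0 add0e.
Qed.

End discrete_integral.

(** * Expectations under a coupling *)

Section transport.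
Local Open Scope ereal_scope.

Lemma marginal_integral d1 d2 (X : measurableType d1) (Y : measurableType d2)
    (R : realType) (phi : X -> Y) (P : probability X R) (Q : probability Y R)
    (f : Y -> \bar R) : measurable_fun setT phi ->
  (forall A, measurable A -> P (phi @^-1` A) = Q A) -> Q.-integrable setT f ->
  P.-integrable setT (f \o phi) /\
  \int[P]_x (f \o phi) x = \int[Q]_y f y.
Proof.
move=> mphi PQ fQ; have mf := measurable_int Q fQ.
have QE g : \int[Q]_y g y = \int[pushforward P phi]_y g y.
  by apply: eq_measure_integral => A mA _; exact/esym/PQ.
have fP : P.-integrable setT (f \o phi).
  apply/integrableP; split; first exact: measurableT_comp.
  move/integrableP : fQ => [_]; rewrite QE ge0_integral_pushforward//.
  exact: measurableT_comp.
by split => //; rewrite QE integral_pushforward.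
Qed.

Context (R : realType) (m : nat).
Implicit Types Q : probability (borelRV R m) R.

Lemma closed_borel_measurable (A : set 'rV[R]_m) : closed A ->
  measurable (A : set (borelRV R m)).
Proof.
move=> cA; rewrite -[A]setCK; apply: (@measurableC _ (borelRV R m)).
by apply: sub_sigma_algebra; exact: closed_openC.
Qed.

Lemma continuous_borel_measurable (s : 'rV[R]_m -> R) : continuous s ->
  measurable_fun setT (s : borelRV R m -> R).
Proof.
move=> /continuousP cs; apply: (measurability _ (RGenOpens.measurableE R)).
move=> _ [_ [a [b ->] <-]]; rewrite setTI; apply: sub_sigma_algebra.
by apply: cs; exact: interval_open.
Qed.

(** Integrate [f y - s x <= l * nrm (x - y)] over the coupling: by its marginals
    the left-hand side becomes a difference of expectations. *)
Lemma transport_bound (nrm : 'rV[R]_m -> R) (Xi : set 'rV[R]_m)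
    (Q0 Q : probability (borelRV R m) R)
    (Pi : probability (borelRV R m * borelRV R m)%type R)
    (f : borelRV R m -> \bar R) (s : borelRV R m -> R) (l : R) :
  (forall x, 0 <= nrm x)%R -> closed Xi -> (0 <= l)%R -> coupling Q0 Q Pi ->
  Q0 (Xi : set (borelRV R m)) = 1 -> Q (Xi : set (borelRV R m)) = 1 ->
  Q.-integrable setT f -> Q0.-integrable setT (EFin \o s) ->
  (forall x y, Xi x -> Xi y -> f y <= (s x + l * nrm (x - y)%R)%:E) ->
  \int[Q]_y f y <= \int[Q0]_x (s x)%:E +
    l%:E * \int[Pi]_(z in Xi `*` Xi)
      (nrm ((z.1 : 'rV[R]_m) - (z.2 : 'rV[R]_m))%R)%:E.
Proof.
move=> nrm0 cXi l0 [Pi1 Pi2] Q0Xi QXi fQ sQ fs.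
have mXi := closed_borel_measurable cXi.
have [fPi <-] := marginal_integral measurable_snd Pi2 fQ.
have [sPi sE] := marginal_integral measurable_fst Pi1 sQ.
have mXX : measurable ((Xi : set (borelRV R m)) `*` (Xi : set (borelRV R m))).
  exact: measurableX.
have sfin : \int[Pi]_z ((EFin \o s) \o fst) z \is a fin_num.
  exact: integrable_fin_num.
rewrite -[X in X + _]sE -leeBlDl// -integralB//.
set F := (X in \int[Pi]_z X z).
have FPi : Pi.-integrable setT F by exact: integrableB.
have mF := measurable_int Pi FPi.
have PiC : Pi (~` ((Xi : set (borelRV R m)) `*` (Xi : set (borelRV R m)))) = 0.
  have -> : ~` ((Xi : set (borelRV R m)) `*` (Xi : set (borelRV R m))) =
      fst @^-1` (~` Xi) `|` snd @^-1` (~` Xi).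
    by apply/predeqP => z /=; split=> [/not_andP|/not_andP].
  have mXiC : measurable (~` Xi : set (borelRV R m)) by exact: measurableC.
  apply/eqP; rewrite eq_le measure_ge0 andbT.
  have C0 (P : probability (borelRV R m) R) : P (Xi : set (borelRV R m)) = 1 ->
      P (~` Xi : set (borelRV R m)) = 0.
    by move=> PXi; rewrite probability_setC// PXi subee.
  rewrite (le_trans (measureU2 _ _ _))//=.
  - by rewrite -[X in measurable X]setTI; exact: measurable_fst.
  - by rewrite -[X in measurable X]setTI; exact: measurable_snd.
  - by rewrite Pi1// Pi2// !C0// adde0.
apply: (@le_trans _ _ (\int[Pi]_z F^\+ z)).
  apply: le_integral => //; first exact: integrable_funepos.
  by move=> z _; rewrite funeposE le_max lexx.
rewrite (ge0_negligible_integral _ _ _ _ PiC)//; last 2 first.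
- exact: measurableC.
- exact: measurable_funepos.
rewrite setDE setTI setCK; apply: ge0_integral_le_scaled => //.
- by apply: measurable_funTS; exact: measurable_funepos.
- by move=> z _; rewrite lee_fin.
move=> z [z1 z2]; rewrite funeposE ge_max mule_ge0 ?lee_fin// andbT.
by rewrite leeBlDl//= -EFinM -EFinD; exact: fs.
Qed.

(** Linear growth and the finite first moment of [Q] bound the positive part, so
    an infinite negative part would make the expectation [-oo]. *)
Lemma eexpectation_integrable (nrm : 'rV[R]_m -> R) (Xi : set 'rV[R]_m)
    (Q : probability (borelRV R m) R) (f : borelRV R m -> \bar R) (A B : R) :
  is_norm nrm -> distributions nrm Xi Q -> measurable_fun setT f ->
  (0 <= A)%R -> (0 <= B)%R -> (forall x, f x <= (A + B * nrm x)%:E) ->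
  -oo < eexpectation Q f ->
  Q.-integrable setT f /\ eexpectation Q f = \int[Q]_x f x.
Proof.
move=> nrm_norm [_ nrmQ] mf A0 B0 fAB.
have nrm0 := is_norm_ge0 nrm_norm.
have mnrm := continuous_borel_measurable (is_norm_continuous nrm_norm).
have nrmI : Q.-integrable setT (EFin \o (nrm : borelRV R m -> R)).
  apply/integrableP; split; first exact/measurable_EFinP.
  rewrite (eq_integral (fun x : borelRV R m => (nrm x)%:E))// => x _.
  by rewrite /= ger0_norm.
have posE : \int[Q]_x maxe (f x) 0 = \int[Q]_x f^\+ x.
  by apply: eq_integral => x _; rewrite funeposE.
have negE : \int[Q]_x mine (f x) 0 = - \int[Q]_x f^\- x.
  rewrite -integral_ge0N//; apply: eq_integral => x _.
  by rewrite funenegE oppe_max oppeK oppe0.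
have pos_fin : \int[Q]_x f^\+ x \is a fin_num.
  rewrite ge0_fin_numE; last exact: integral_ge0.
  apply: (@le_lt_trans _ _ (\int[Q]_x (A%:E + B%:E * (nrm x)%:E))).
    apply: ge0_le_integral_unmeasurable => x _ //.
    rewrite funeposE ge_max -EFinM -EFinD fAB lee_fin addr_ge0//.
    by rewrite mulr_ge0.
  apply: integrable_lty => //; apply: integrableD => //.
    exact: finite_measure_integrable_cst.
  exact: integrableZl.
rewrite /eexpectation posE negE => Eoo.
have neg_fin : \int[Q]_x f^\- x \is a fin_num.
  rewrite ge0_fin_numE; last exact: integral_ge0.
  rewrite ltNge leye_eq; apply/negP => /eqP neg_oo.
  move: Eoo; rewrite neg_oo /=; move: pos_fin.
  by case: (\int[Q]_x f^\+ x).
split; last first.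
  rewrite DualAddTheoryNumDomain.dual_addeE_def ?fin_num_adde_defr//.
  by rewrite [RHS]integralE.
apply/integrableP; split => //.
rewrite -[fun x => _]/(abse \o f) fune_abse ge0_integralD//.
- by apply: lte_add_pinfty; rewrite -ge0_fin_numE//; exact: integral_ge0.
- exact: measurable_funepos.
- exact: measurable_funeneg.
Qed.

End transport.

(** * Weak duality *)

Section weak_duality.
Context (R : realType) (m N K : nat).
Variables (nrm : 'rV[R]_m -> R) (Xi : set 'rV[R]_m).
Variables (xihat : 'I_N -> 'rV[R]_m) (ell : 'I_K -> 'rV[R]_m -> \bar R).
Hypotheses (N_gt0 : (0 < N)%N) (K_gt0 : (0 < K)%N) (nrm_norm : is_norm nrm).
Hypothesis (Xi_closed : closed Xi).
Hypothesis xihat_Xi : forall i, Xi (xihat i).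
Hypothesis ell_measurable :
  forall k, measurable_fun setT (ell k : borelRV R m -> \bar R).
Hypothesis ell_proper : forall k, proper_fun (fun x => - ell k x)%E.
Hypothesis ell_convex : forall k, convex_efun setT (fun x => - ell k x)%E.
Hypothesis ell_lsc : forall k, lower_semicontinuous (fun x => - ell k x)%E.
Hypothesis ell_Xi : forall k, ~ (forall x, Xi x -> ell k x = -oo%E).
Local Notation attainable := (attainable nrm Xi xihat ell).

Lemma le_max_lossP (r : R) x :
  (r%:E <= max_loss ell x)%E <-> exists k, (r%:E <= ell k x)%E.
Proof.
split=> [/bigmax_geP[|[k _ rk]]|[k rk]]; first by rewrite leeNy_eq.
  by exists k.
by apply/bigmax_geP; right; exists k.
Qed.

Lemma max_loss_lty x : (max_loss ell x < +oo)%E.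
Proof.
apply/bigmax_ltP; split => //.
by move=> k _; exact: proper_lty.
Qed.

Lemma measurable_max_loss :
  measurable_fun setT (max_loss ell : borelRV R m -> \bar R).
Proof.
rewrite /max_loss; elim: (index_enum _) => [|k s ih].
  by under eq_fun do rewrite big_nil; exact: measurable_cst.
by under eq_fun do rewrite big_cons; exact: measurable_maxe.
Qed.

Lemma max_loss_growth : exists A B : R, [/\ 0 <= A, 0 <= B &
  forall x, (max_loss ell x <= (A + B * nrm x)%:E)%E].
Proof.
have /choice[A /choice[B AB]] : forall k, exists A B : R, [/\ 0 <= A, 0 <= B &
    forall x, (ell k x <= (A + B * nrm x)%:E)%E].
  by move=> k; exact: linear_growth.
exists (\sum_k A k), (\sum_k B k); split.
- by apply: sumr_ge0 => k _; case: (AB k).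
- by apply: sumr_ge0 => k _; case: (AB k).
move=> x; apply/bigmax_leP; split; first by rewrite leNye.
move=> k _; have [_ _ /(_ x)/le_trans] := AB k; apply.
rewrite lee_fin lerD//.
  by rewrite (bigD1 k)//= lerDl sumr_ge0// => j _; case: (AB j).
rewrite ler_wpM2r ?(is_norm_ge0 nrm_norm)//.
by rewrite (bigD1 k)//= lerDl sumr_ge0// => j _; case: (AB j).
Qed.

(** Some [ell k] equals the loss at [z i], and all the mass of sample [i] goes
    to that [k]. *)
Lemma attainable_points (z : 'I_N -> 'rV[R]_m) (r : 'I_N -> R) :
  (forall i, Xi (z i)) -> (forall i, ((r i)%:E <= max_loss ell (z i))%E) ->
  attainable (N%:R^-1 * (\sum_i nrm (xihat i - z i))) (N%:R^-1 * (\sum_i r i)).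
Proof.
move=> zXi rz; have /choice[k kP] i := (le_max_lossP (r i) (z i)).1 (rz i).
have sum1 (F : 'I_N -> R) i : \sum_j (j == k i)%:R * F i = F i.
  rewrite (bigD1 (k i))//= eqxx mul1r big1 ?addr0// => j /negbTE ->.
  by rewrite mul0r.
have -> : \sum_i nrm (xihat i - z i) =
    \sum_i \sum_j (j == k i)%:R * nrm (xihat i - z i).
  by apply: eq_bigr => i _; rewrite (sum1 (fun i => nrm (xihat i - z i))).
have -> : \sum_i r i = \sum_i \sum_j (j == k i)%:R * r i.
  by apply: eq_bigr => i _; rewrite sum1.
apply: (@attainable_plan _ _ _ _ _ _ _ _ N_gt0 nrm_norm xihat_Xi ell_proper
  (fun i j => (j == k i)%:R) (fun i _ => z i) (fun i j => (j == k i)%:R * r i))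
  => // [i|i j].
  by have := sum1 (cst 1) i; under eq_bigr do rewrite mulr1.
by rewrite EFinM; case: eqVneq => [->|_]; rewrite ?mul0e// lee_wpmul2l.
Qed.

Definition penalized_losses l (x : 'rV[R]_m) : set R :=
  [set z | exists y r, [/\ Xi y, (r%:E <= max_loss ell y)%E &
    z = r - l * nrm (x - y)]].

(** The Kantorovich [c]-transform of the loss on [Xi], for the cost
    [l * nrm (x - y)]. Since a loss may be [-oo], real lower bounds of the loss
    are used in its place, which does not change the supremum. *)
Definition loss_transform l (x : 'rV[R]_m) : R := sup (penalized_losses l x).

Section loss_transform.
Variables (a l eps : R).
Hypothesis l_ge0 : 0 <= l.
Hypothesis G_below : forall c o, attainable c o -> o <= a + l * (c - eps).

Let S := penalized_losses l.

Let points_below (y : 'I_N -> 'rV[R]_m) (r : 'I_N -> R) :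
  (forall i, Xi (y i)) -> (forall i, ((r i)%:E <= max_loss ell (y i))%E) ->
  \sum_i (r i - l * nrm (xihat i - y i)) <= N%:R * (a - l * eps).
Proof.
move=> yXi /(attainable_points yXi)/G_below.
have N0 : 0 < N%:R :> R by rewrite ltr0n.
rewrite -(ler_pM2l N0) mulrA divff ?gt_eqF// mul1r mulrDr mulrBr => H.
rewrite sumrB -mulr_sumr lerBlDr (le_trans H)//.
by rewrite le_eqVlt; apply/orP; left; apply/eqP; field; rewrite gt_eqF.
Qed.

Let Xi_finite : exists y r, Xi y /\ (r%:E <= max_loss ell y)%E.
Proof.
have [y yP] : exists y, ~ (Xi y -> ell (Ordinal K_gt0) y = -oo%E).
  by apply: contrapT => H; apply: (ell_Xi (k := Ordinal K_gt0)) => y;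
    apply: contrapT => yP; apply: H; exists y.
move/not_implyP : yP => [Xiy ellN].
case ellE : (ell (Ordinal K_gt0) y) => [r||]; last 2 first.
- by have := proper_lty (ell_proper (Ordinal K_gt0)) y; rewrite ellE.
- by [].
exists y, r; split => //; apply/le_max_lossP.
by exists (Ordinal K_gt0); rewrite ellE.
Qed.

Let S_nonempty x : S x !=set0.
Proof.
by have [y [r [yXi ry]]] := Xi_finite; exists (r - l * nrm (x - y)), y, r.
Qed.

Let shift x x' y : nrm (x' - y) <= nrm (x - y) + nrm (x' - x).
Proof.
have -> : x' - y = (x - y) + (x' - x) by rewrite [RHS]addrC addrA subrK.
exact: is_norm_triangle.
Qed.

(** Freezing all atoms but one turns the bound on sums into a bound on the
    values of a single atom. *)
Let S_bounded x : has_ubound (S x).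
Proof.
have [y0 [r0 [y0Xi ry0]]] := Xi_finite.
have [i0 _] : exists i0 : 'I_N, True by exists (Ordinal N_gt0).
pose rest := \sum_(i | i != i0) (r0 - l * nrm (xihat i - y0)).
exists (N%:R * (a - l * eps) - rest + l * nrm (xihat i0 - x)).
move=> _ [y [r [yXi ry ->]]].
have yXi' i : Xi (if i == i0 then y else y0) by case: ifP.
have ry' i : ((if i == i0 then r else r0)%:E <=
    max_loss ell (if i == i0 then y else y0))%E by case: ifP.
have := points_below yXi' ry'.
rewrite (bigD1 i0)//= eqxx.
have -> : \sum_(i < N | i != i0) ((if i == i0 then r else r0) -
    l * nrm (xihat i - (if i == i0 then y else y0))) = rest.
  by apply: eq_bigr => i /negbTE ->.
have := ler_wpM2l l_ge0 (shift x (xihat i0) y).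
by rewrite mulrDr; lra.
Qed.

Let S_sup x : has_sup (S x).
Proof. by split. Qed.

Lemma max_loss_le_transform x y : Xi y ->
  (max_loss ell y <= (loss_transform l x + l * nrm (x - y))%:E)%E.
Proof.
move=> yXi; case yE : (max_loss ell y) => [r||]; last 2 first.
- by have := max_loss_lty y; rewrite yE.
- by rewrite leNye.
rewrite lee_fin -lerBlDr; apply: (ub_le_sup (S_bounded x)).
by exists y, r; split => //; rewrite yE.
Qed.

Lemma loss_transform_lipschitz x x' :
  loss_transform l x <= loss_transform l x' + l * nrm (x - x').
Proof.
apply: ge_sup => [|_ [y [r [yXi ry ->]]]]; first exact: S_nonempty.
have : r - l * nrm (x' - y) <= loss_transform l x'.
  by apply: (ub_le_sup (S_bounded x')); exists y, r.
have := ler_wpM2l l_ge0 (shift x x' y).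
rewrite -(is_normN nrm_norm (x' - x)) opprB mulrDr; lra.
Qed.

(** The atoms of the samples are chosen independently of each other, so the sum
    of the suprema is the supremum of the sums. *)
Lemma sum_loss_transform :
  N%:R^-1 * (\sum_i loss_transform l (xihat i)) <= a - l * eps.
Proof.
have N0 : 0 < N%:R :> R by rewrite ltr0n.
rewrite -(ler_pM2l N0) mulrA divff ?gt_eqF// mul1r.
apply/ler_addgt0Pr => e e0.
have /choice[y /choice[r yr]] : forall i, exists y r,
    [/\ Xi y, (r%:E <= max_loss ell y)%E &
      loss_transform l (xihat i) - e / N%:R < r - l * nrm (xihat i - y)].
  move=> i; have [_ [y [r [yXi ry ->]]] lt_z] :=
    sup_adherent (divr_gt0 e0 N0) (S_sup (xihat i)).
  by exists y, r.
rewrite -lerBlDr.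
have yXi i : Xi (y i) by have [] := yr i.
have ry i : ((r i)%:E <= max_loss ell (y i))%E by have [] := yr i.
apply: le_trans (points_below yXi ry).
have -> : e = \sum_(i < N) e / N%:R.
  by rewrite sumr_const card_ord -[RHS]mulr_natr divfK// gt_eqF.
by rewrite -sumrB ler_sum// => i _; have [_ _ /ltW] := yr i.
Qed.

End loss_transform.

(** Otherwise all attainable values lie below the line of slope [l] through
    [(eps, a)]. The loss transform then averages to at most [a - l * eps] over
    the samples, and a transport of cost arbitrarily close to [eps] adds back at
    most about [l * eps], so the expectation under [Q] does not exceed [a]. *)
Lemma weak_duality (Q : probability (borelRV R m) R) (eps a l : R) :
  wasserstein_ball nrm Xi (empirical_distribution xihat N_gt0) eps Q ->
  0 <= l -> (a%:E < eexpectation Q (max_loss ell))%E ->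
  exists c o, attainable c o /\ a + l * (c - eps) < o.
Proof.
move=> [distQ ballQ] l0 aE; apply: contrapT => H.
have G_below c o : attainable c o -> o <= a + l * (c - eps).
  by move=> Gco; rewrite leNgt; apply/negP => lt_o; apply: H; exists c, o.
have [A [B [A0 B0 fAB]]] := max_loss_growth.
have [fQ EQ] := eexpectation_integrable nrm_norm distQ measurable_max_loss
  A0 B0 fAB (lt_trans (ltNyr a) aE).
set s := loss_transform l.
have ms : measurable_fun setT (s : borelRV R m -> R).
  apply: continuous_borel_measurable; apply: (lipschitz_continuous nrm_norm l0).
  exact: (loss_transform_lipschitz l0 G_below).
have P0Xi : empirical_distribution xihat N_gt0 (Xi : set (borelRV R m)) = 1%E.
  transitivity (\sum_(i < N) (N%:R^-1)%:E *
    @dirac _ (borelRV R m) (xihat i) R Xi)%E; first by [].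
  under eq_bigr do rewrite diracE mem_set// mule1.
  by rewrite sumEFin empirical_sum1.
move: aE; rewrite EQ ltNge => /negP; apply.
apply/lee_addgt0Pr => e e0.
have d0 : 0 < e / (l + 1) by rewrite divr_gt0// ltr_wpDl.
have : (wasserstein nrm Xi (empirical_distribution xihat N_gt0) Q <
    (eps + e / (l + 1))%:E)%E.
  by rewrite (le_lt_trans ballQ)// lte_fin ltrDl.
move=> /ereal_inf_lt[_ [Pi cPi <-] costPi].
have := transport_bound (is_norm_ge0 nrm_norm) Xi_closed l0 cPi P0Xi distQ.1 fQ
  (integrable_discrete _ _ _ ms)
  (fun x y _ => max_loss_le_transform l0 G_below x (y := y)).
rewrite integral_discrete// => /le_trans; apply.
apply: (@le_trans _ _ ((a - l * eps)%:E + l%:E * (eps + e / (l + 1))%:E)%E).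
  apply: leeD; last by rewrite lee_wpmul2l// ltW.
  by rewrite lee_fin -mulr_sumr; exact: sum_loss_transform l0 G_below.
rewrite -EFinM -EFinD lee_fin.
have : l * (e / (l + 1)) <= e.
  by rewrite mulrCA ger_pMr// ler_pdivrMr ?mul1r ?lerDl// ltr_wpDl.
by rewrite mulrDr; lra.
Qed.

End weak_duality.

(** * Worst-case expectation and optimal value *)

Section conclusion.
Context (R : realType) (m N K : nat).
Variables (nrm : 'rV[R]_m -> R) (Xi : set 'rV[R]_m).
Variables (xihat : 'I_N -> 'rV[R]_m) (ell : 'I_K -> 'rV[R]_m -> \bar R).
Variable eps : R.
Hypotheses (N_gt0 : (0 < N)%N) (K_gt0 : (0 < K)%N) (nrm_norm : is_norm nrm).
Hypothesis (Xi_convex : convex_set Xi) (Xi_closed : closed Xi).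
Hypothesis xihat_Xi : forall i, Xi (xihat i).
Hypothesis ell_measurable :
  forall k, measurable_fun setT (ell k : borelRV R m -> \bar R).
Hypothesis ell_proper : forall k, proper_fun (fun x => - ell k x)%E.
Hypothesis ell_convex : forall k, convex_efun setT (fun x => - ell k x)%E.
Hypothesis ell_lsc : forall k, lower_semicontinuous (fun x => - ell k x)%E.
Hypothesis ell_Xi : forall k, ~ (forall x, Xi x -> ell k x = -oo%E).
Implicit Types v : decision R m N K.
Local Notation attainable := (attainable nrm Xi xihat ell).
Local Notation objective := (objective xihat ell).
Local Notation feasible := (feasible nrm Xi xihat eps).

Lemma objective_lty v : feasible v -> (objective v < +oo)%E.
Proof.
move=> /(feasibleP _ xihat_Xi)[_ _ v0 _].
have Foo i k : ((v.1 i k)%:E * ell k (atom xihat v i k) < +oo)%E.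
  by rewrite perspective_lty.
rewrite lte_mul_pinfty ?lee_fin ?invr_ge0//.
rewrite dsum_ltey => [|i]; last first.
  by rewrite (dsum_ltey (Foo i)); apply: lte_sum_pinfty.
apply: lte_sum_pinfty => i _.
by rewrite (dsum_ltey (Foo i)); apply: lte_sum_pinfty.
Qed.

Lemma convex_program_feasible : convex_program nrm Xi xihat ell eps.
Proof.
have mix (t : {i01 R}) v1 v2 : feasible v1 -> feasible v2 ->
    let v := t%:num *: v1 + (1 - t%:num) *: v2 in
    feasible v /\ forall o1 o2, (o1%:E <= objective v1)%E ->
    (o2%:E <= objective v2)%E ->
    ((t%:num * o1 + (1 - t%:num) * o2)%:E <= objective v)%E.
  move=> fv1 fv2.
  have [] := feasible_conv N_gt0 nrm_norm Xi_convex xihat_Xi ell_proper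
    ell_convex (ge0 t) (le1 t) fv1 fv2.
  by rewrite -mulrDl addrC subrK mul1r.
split.
  move=> v1 v2 t; rewrite !inE => fv1 fv2; exact: (mix t v1 v2 fv1 fv2).1.
move=> t v1 v2; rewrite !inE => fv1 fv2.
have [_] := mix t v1 v2 fv1 fv2.
rewrite -[conv t _ _]/(t%:num *: (v1 : decision R m N K) +
  (1 - t%:num) *: (v2 : decision R m N K)).
have := objective_lty fv1; have := objective_lty fv2.
have : t%:num <= 1 by []; have : 0 <= t%:num by [].
move: (t%:num) => {}t t_ge0 t_le1.
(* at the endpoints 0 * oo = 0 hides an objective equal to -oo *)
have [->|t1] := eqVneq t 1.
  rewrite subrr scale0r scale1r addr0 mul0e mul1e.
  by rewrite DualAddTheoryNumDomain.dadde0.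
have [->|t0] := eqVneq t 0.
  rewrite subr0 scale0r scale1r add0r mul0e mul1e.
  by rewrite DualAddTheoryNumDomain.dadd0e.
have t0' : 0 < t by rewrite lt_neqAle eq_sym t0.
have t1' : 0 < 1 - t by rewrite subr_gt0 lt_neqAle t1.
case: (objective v2) => [b2||]//; case: (objective v1) => [b1||]// _ _ H.
- have := H b1 b2 (lexx _) (lexx _); rewrite -leeN2 => /le_trans; apply.
  by rewrite -!EFinM /= lee_fin; lra.
- by rewrite gt0_muley ?lte_fin// ?DualAddTheoryNumDomain.daddye ?leey.
- by rewrite gt0_muley ?lte_fin// ?DualAddTheoryNumDomain.daddey ?leey.
- by rewrite gt0_muley ?lte_fin// ?DualAddTheoryNumDomain.daddye ?leey.
Qed.

(** Weak duality feeds the supporting line argument for every real [a] below the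
    expectation under [Q], which yields a decision of budget [eps] worth [a]. *)
Lemma worst_case_le_optimal_value :
  (worst_case_expectation nrm Xi xihat ell eps N_gt0 <=
    optimal_value nrm Xi xihat ell eps)%E.
Proof.
apply: ge_ereal_sup => _ [Q ballQ <-]; apply: lee_real_lt => a aE.
have [A [B [A0 B0 AB]]] :=
  piece_growth xihat nrm_norm ell_proper ell_convex ell_lsc.
have [ o [v fv ov] ao] : exists2 o, attainable eps o & a <= o.
  apply: (@dual_attained _ attainable a A B eps) => //.
  - by move=> *; apply: attainable_conv.
  - by move=> c1 c2 o; apply: attainable_mono.
  - exact: (attainable_growth N_gt0 xihat_Xi ell_proper B0 AB).
  - move=> u w uw ueps aw.
    exact: (attainable_limit N_gt0 nrm_norm Xi_closed xihat_Xi ell_proper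
      ell_lsc A0 B0 AB uw ueps aw).
  - move=> l l0; exact: (weak_duality K_gt0 nrm_norm Xi_closed xihat_Xi
      ell_measurable ell_proper ell_convex ell_lsc ell_Xi ballQ l0 aE).
apply: (@le_trans _ _ (objective v)); last by apply: ereal_sup_ubound; exists v.
by rewrite (le_trans _ ov)// lee_fin.
Qed.

Lemma average_dsum (F : 'I_N -> 'I_K -> \bar R) :
  (forall i k, (F i k < +oo)%E) ->
  ((N%:R^-1)%:E * \sum_(i < N) \sum_(k < K) F i k)%dE =
  (\sum_(p : 'I_N * 'I_K) (N%:R^-1)%:E * F p.1 p.2)%E.
Proof.
move=> Foo; transitivity ((N%:R^-1)%:E * \sum_p F p.1 p.2)%E.
  congr (_ * _)%E; rewrite -(pair_bigA _ F)/= dsum_ltey => [|i]; last first.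
    by rewrite (dsum_ltey (Foo i)); apply: lte_sum_pinfty.
  by apply: eq_bigr => i _; rewrite (dsum_ltey (Foo i)).
by rewrite fin_num_sume_distrr// => i j _ _; rewrite ltpinfty_adde_def ?inE.
Qed.

Lemma average_lossE v (fv : feasible v) :
  ((N%:R^-1)%:E * \sum_(i < N) \sum_(k < K)
     (v.1 i k)%:E * max_loss ell (atom xihat v i k))%dE =
  eexpectation (decision_distribution N_gt0 fv) (max_loss ell).
Proof.
have [_ _ v0 _] := (feasibleP _ xihat_Xi _ _).1 fv.
rewrite average_dsum => [|i k]; last first.
  by rewrite lte_mul_pinfty ?lee_fin// max_loss_lty.
rewrite eexpectation_discrete.
- by apply: eq_bigr => p _; rewrite EFinM muleA.
- exact: measurable_max_loss.
- exact: max_loss_lty.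
Qed.

Lemma objective_le_expectation v (fv : feasible v) :
  (objective v <=
    eexpectation (decision_distribution N_gt0 fv) (max_loss ell))%E.
Proof.
have [_ _ v0 _] := (feasibleP _ xihat_Xi _ _).1 fv.
rewrite -average_lossE /Defs.objective !average_dsum.
- apply: lee_sum => p _; rewrite lee_wpmul2l// ?lee_fin ?invr_ge0//.
  by rewrite lee_wpmul2l ?lee_fin//; exact: le_bigmax.
- by move=> i k; rewrite lte_mul_pinfty ?lee_fin// max_loss_lty.
- by move=> i k; rewrite perspective_lty.
Qed.

(** Moving the mass of the [(i, k)]-th atom from [xihat i] costs the norm of the
    displacement [q], so the constraint on [q] bounds the transport cost. *)
Lemma decision_distribution_ball v (fv : feasible v) :
  wasserstein_ball nrm Xi (empirical_distribution xihat N_gt0) eps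
    (decision_distribution N_gt0 fv).
Proof.
have [vc v1 v0 vX] := (feasibleP _ xihat_Xi _ _).1 fv.
have nrm0 := is_norm_ge0 nrm_norm.
split.
  split.
    transitivity (\sum_(p : 'I_N * 'I_K) (N%:R^-1 * v.1 p.1 p.2)%:E *
      @dirac _ (borelRV R m) (atom xihat v p.1 p.2) R Xi)%E; first by [].
    rewrite (eq_bigr (fun p => (N%:R^-1 * v.1 p.1 p.2)%:E)) => [|p _].
      by rewrite sumEFin (weights_sum1 N_gt0 fv).
    by rewrite diracE mem_set ?mule1//; exact: (vX p.1 p.2).1.
  apply: le_lt_trans (ge0_integral_discrete_le _ _ _ _) _ => //.
  by apply: lte_sum_pinfty => p _; rewrite -EFinM ltry.
pose P := discrete_distribution
  (fun p : 'I_N * 'I_K => (xihat p.1, atom xihat v p.1 p.2) :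
    (borelRV R m * borelRV R m)%type)
  (weights_ge0 fv) (weights_sum1 N_gt0 fv).
apply: (@le_trans _ _ (\int[P]_(z in Xi `*` Xi)
    (nrm ((z.1 : 'rV[R]_m) - (z.2 : 'rV[R]_m)))%:E)%E).
  apply: ereal_inf_lbound; exists P => //; split => // A mA.
  transitivity (\sum_(p : 'I_N * 'I_K) (N%:R^-1 * v.1 p.1 p.2)%:E *
      @dirac _ (borelRV R m) (xihat p.1) R A)%E; first by [].
  transitivity (\sum_(i < N) (N%:R^-1)%:E *
      @dirac _ (borelRV R m) (xihat i) R A)%E; last by [].
  rewrite -(pair_bigA _ (fun i k => (N%:R^-1 * v.1 i k)%:E *
      @dirac _ (borelRV R m) (xihat i) R A)%E)/=.
  apply: eq_bigr => i _; rewrite diracE.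
  under eq_bigr do rewrite -EFinM.
  by rewrite sumEFin -mulr_suml -mulr_sumr v1 mulr1.
rewrite integral_mkcond; apply: le_trans (ge0_integral_discrete_le _ _ _ _) _.
  by move=> z; rewrite patchE; case: ifP; rewrite lee_fin.
apply: le_trans (_ : (N%:R^-1 * (\sum_i \sum_k nrm (v.2 i k)))%:E <= _)%E.
  rewrite pair_bigA/= mulr_sumr -sumEFin; apply: lee_sum => p _.
  rewrite !EFinM -muleA lee_wpmul2l ?lee_fin ?invr_ge0//.
  rewrite [v.2 p.1 p.2](vX p.1 p.2).2 (is_normZ nrm_norm) ger0_norm//.
  rewrite EFinM lee_wpmul2l ?lee_fin// patchE; case: ifP => // _.
  by rewrite lee_fin.
by rewrite lee_fin.
Qed.

End conclusion.

Theorem theorem4p4 (R : realType) (m N K : nat)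
    (N_gt0 : (0 < N)%N) (K_gt0 : (0 < K)%N)
    (nrm : 'rV[R]_m -> R) (nrm_norm : is_norm nrm)
    (Xi : set 'rV[R]_m) (Xi_convex : convex_set Xi) (Xi_closed : closed Xi)
    (xihat : 'I_N -> 'rV[R]_m) (xihat_Xi : forall i, Xi (xihat i))
    (ell : 'I_K -> 'rV[R]_m -> \bar R)
    (ell_measurable :
       forall k, measurable_fun setT (ell k : borelRV R m -> \bar R))
    (ell_proper : forall k, proper_fun (fun x => - ell k x)%E)
    (ell_convex : forall k, convex_efun setT (fun x => - ell k x)%E)
    (ell_lsc : forall k, lower_semicontinuous (fun x => - ell k x)%E)
    (ell_Xi : forall k, ~ (forall x, Xi x -> ell k x = -oo%E))
    (eps : R) (eps_ge0 : 0 <= eps) :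
  [/\ convex_program nrm Xi xihat ell eps,
      worst_case_expectation nrm Xi xihat ell eps N_gt0 =
        optimal_value nrm Xi xihat ell eps &
      forall (v : nat -> decision R m N K)
        (v_feasible : forall r, feasible nrm Xi xihat eps (v r)),
        objective xihat ell (v r) @[r --> \oo] -->
          optimal_value nrm Xi xihat ell eps ->
        [/\ forall r,
              wasserstein_ball nrm Xi (empirical_distribution xihat N_gt0) eps
                (decision_distribution N_gt0 (v_feasible r)),
            eexpectation (decision_distribution N_gt0 (v_feasible r))
              (max_loss ell) @[r --> \oo] -->
              worst_case_expectation nrm Xi xihat ell eps N_gt0 &
            ((N%:R^-1)%:E * \sum_(i < N) \sum_(k < K)
               ((v r).1 i k)%:E * max_loss ell (atom xihat (v r) i k))%dE
              @[r --> \oo] -->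
              worst_case_expectation nrm Xi xihat ell eps N_gt0]].
Proof.
have WV : worst_case_expectation nrm Xi xihat ell eps N_gt0 =
    optimal_value nrm Xi xihat ell eps.
  apply/eqP; rewrite eq_le worst_case_le_optimal_value//=.
  apply: ge_ereal_sup => _ [v fv <-].
  rewrite (le_trans (objective_le_expectation N_gt0 xihat_Xi ell_measurable
    ell_proper fv))//.
  apply: ereal_sup_ubound; exists (decision_distribution N_gt0 fv) => //.
  exact: decision_distribution_ball.
split => //; first exact: convex_program_feasible.
move=> v fv obj_cvg.
have ball r := decision_distribution_ball N_gt0 nrm_norm xihat_Xi (fv r).
have expectation_cvg : eexpectation (decision_distribution N_gt0 (fv r))
    (max_loss ell) @[r --> \oo] -->
    worst_case_expectation nrm Xi xihat ell eps N_gt0.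
  rewrite WV; apply: (squeeze_cvge _ obj_cvg (cvg_cst _)).
  apply: nearW => r; rewrite objective_le_expectation//= -WV.
  by apply: ereal_sup_ubound; exists (decision_distribution N_gt0 (fv r)).
split => //.
under eq_fun do rewrite (average_lossE N_gt0 xihat_Xi ell_measurable ell_proper
  (fv _)).
by [].
Qed.
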